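(* Let $A$ be an integral domain, let $E$ be a nonzero $A$-module, and let $R := A\ltimes E$ be the trivial ring extension of $A$ by $E$. Then $R$ is semi-regular if and only if one of the following holds: (i) $A$ is a field and $E\cong A$ as $A$-modules; or (ii) $A$ is a coherent domain, $E$ is a divisible torsion coherent $A$-module which satisfies (DAC), and $\operatorname{Ann}_E(x)$ is a finitely generated $A$-module for every nonzero $x\in A$. Moreover, the same equivalence holds when ''divisible'' in (ii) is replaced by ''fp-injective''.
   Context: All rings are commutative with identity and all modules are unital. For a ring $A$ and an $A$-module $E$, the trivial ring extension $A\ltimes E$ is the ring with underlying additive group $A\times E$ and multiplication $(a,e)(b,f)=(ab,af+be)$. A ring is semi-regular if every module over it can be embedded in a flat module (equivalently, every injective module is flat). A ring is coherent if every finitely generated ideal is finitely presented. An $A$-module is coherent if all of its finitely generated submodules are finitely presented (the module itself need not be finitely generated). An $A$-module $E$ is fp-injective if $\operatorname{Ext}^1_A(M,E)=0$ for every finitely presented $A$-module $M$. A module $E$ over a domain $A$ is divisible if $aE=E$ for every nonzero $a\in A$, and torsion if every element of $E$ is annihilated by some nonzero element of $A$. ''Torsion coherent'' means torsion and coherent. For an ideal $I$ of $A$, $\operatorname{Ann}_E(I)=\{e\in E: Ie=0\}$; for $x\in A$, $\operatorname{Ann}_E(x)=\{e\in E: xe=0\}$; for a subset $S$ of $E$, $\operatorname{Ann}_A(S)=\{a\in A: aS=0\}$. An $A$-module $E$ satisfies the double annihilator condition (DAC) if both of the following hold: (DAC1) $\operatorname{Ann}_A(\operatorname{Ann}_E(I))=I$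 for every finitely generated ideal $I$ of $A$; (DAC2) $\operatorname{Ann}_E(\operatorname{Ann}_A(E'))=E'$ for every finitely generated submodule $E'$ of $E$. *)

(* Defs.v *)
From HB Require Import structures.
From mathcomp Require Import all_boot all_order all_algebra.
From mathcomp Require Import boolp classical_sets.

Set Implicit Arguments.
Unset Strict Implicit.
Unset Printing Implicit Defensive.

Import GRing.Theory.
Local Open Scope classical_set_scope.
Local Open Scope ring_scope.
Local Open Scope quotient_scope.

Definition trivext (A : comNzRingType) (E : lmodType A) : Type := (A * E)%type.

Section TrivialExtension.
Variables (A : comNzRingType) (E : lmodType A).

HB.instance Definition _ := GRing.Zmodule.copy (trivext E) (A * E)%type.

Definition trivext_one : trivext E := (1, 0).
Definition trivext_mul (x y : trivext E) : trivext E :=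
  (x.1 * y.1, x.1 *: y.2 + y.1 *: x.2).

Fact trivext_mulA : associative trivext_mul.
Proof.
move=> x y z; rewrite /trivext_mul /= mulrA !scalerDr !scalerA -addrA.
by rewrite [z.1 * x.1]mulrC [z.1 * y.1]mulrC.
Qed.

Fact trivext_mulC : commutative trivext_mul.
Proof. by move=> x y; rewrite /trivext_mul mulrC addrC. Qed.

Fact trivext_mul1 : left_id trivext_one trivext_mul.
Proof.
by case=> a e; rewrite /trivext_mul /= mul1r scale1r scaler0 addr0.
Qed.

Fact trivext_mulDl : left_distributive trivext_mul +%R.
Proof.
move=> x y z; rewrite /trivext_mul /= mulrDl scalerDl scalerDr.
by rewrite addrACA.
Qed.

Fact trivext_oner_neq0 : trivext_one != 0.
Proof. by rewrite /trivext_one xpair_eqE negb_and oner_neq0. Qed.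

HB.instance Definition _ :=
  GRing.Zmodule_isComNzRing.Build (trivext E)
    trivext_mulA trivext_mulC trivext_mul1 trivext_mulDl trivext_oner_neq0.

End TrivialExtension.

(* The subset S of M, viewed as a module in its own right. *)
Section SubModule.
Variables (A : comNzRingType) (M : lmodType A) (S : submodClosed M).

Record submod : Type := SubMod { submod_val : M; _ : submod_val \in S }.

HB.instance Definition _ := [isSub for submod_val].
HB.instance Definition _ := [Choice of submod by <:].
HB.instance Definition _ := [SubChoice_isSubLmodule of submod by <:].

End SubModule.

Section Finiteness.
Variable A : comNzRingType.
Implicit Types M N P : lmodType A.

Definition finitely_generated M : Prop :=
  exists (n : nat) (s : 'I_n -> M),
    forall x : M, exists c : 'I_n -> A, x = \sum_(i < n) c i *: s i.

Definition exact_at M N P (f : M -> N) (g : N -> P) : Prop :=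
  range f = g @^-1` [set 0].

Definition finitely_presented M : Prop :=
  exists (m n : nat) (g : {linear 'rV[A]_m -> 'rV[A]_n})
         (f : {linear 'rV[A]_n -> M}),
    exact_at g f /\ range f = setT.

Definition coherent_module M : Prop :=
  forall S : submodClosed M,
    finitely_generated (submod S) -> finitely_presented (submod S).

End Finiteness.

(* The ideals of A are the submodules of the regular module A^o. *)
Definition coherent_ring (A : comNzRingType) : Prop :=
  forall I : submodClosed A^o,
    finitely_generated (submod I) -> finitely_presented (submod I).

Section Tensor.
Variable A : comNzRingType.
Implicit Types M N P T : lmodType A.

Definition is_tensor N M T (t : {bilinear N -> M -> T}) : Prop :=
  forall P (b : {bilinear N -> M -> P}),
    exists! g : T -> P, linear g /\ forall x y, g (t x y) = b x y.

End Tensor.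

(* N (x) M: formal sums of pairs, two being identified when all bilinear maps
   agree on them. *)
Section TensorExists.
Variables (A : comNzRingType) (N M : lmodType A).

Implicit Types P Q : lmodType A.

Let formal := seq (N * M).
Let eval (P : lmodType A) (b : {bilinear N -> M -> P}) (u : formal) : P :=
  \sum_(x <- u) b x.1 x.2.

Let tensor_eq (u v : formal) : bool :=
  `[< forall (P : lmodType A) (b : {bilinear N -> M -> P}),
        eval b u = eval b v >].

Let tensor_eq_refl : reflexive tensor_eq.
Proof. by move=> u; apply/asboolP. Qed.
Let tensor_eq_sym : symmetric tensor_eq.
Proof. by move=> u v; apply/asboolP/asboolP. Qed.
Let tensor_eq_trans : transitive tensor_eq.
Proof.
by move=> v u w /asboolP uv /asboolP vw; apply/asboolP=> P b; rewrite uv.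
Qed.

Definition tensor_rel : equiv_rel formal :=
  EquivRel tensor_eq tensor_eq_refl tensor_eq_sym tensor_eq_trans.
Definition tensor : Type := {eq_quot tensor_rel}.
HB.instance Definition _ := Choice.on tensor.
HB.instance Definition _ := EqQuotient.on tensor.

Let teval P (b : {bilinear N -> M -> P}) (t : tensor) : P := eval b (repr t).

Let teval_pi P (b : {bilinear N -> M -> P}) u : teval b (\pi_tensor u) = eval b u.
Proof.
by rewrite /teval; case: piP => v /eqmodP /asboolP uv; rewrite -uv.
Qed.

Let tensor_ext (s t : tensor) : (forall P b, @teval P b s = teval b t) -> s = t.
Proof.
by move=> st; rewrite -[s]reprK -[t]reprK; apply/eqmodP/asboolP=> P b; apply: st.
Qed.

Let scal (a : A) (u : formal) : formal := [seq (a *: x.1, x.2) | x <- u].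
Let eval_scal P (b : {bilinear N -> M -> P}) a u :
  eval b (scal a u) = a *: eval b u.
Proof.
rewrite /eval big_map scaler_sumr; apply: eq_bigr => x _.
by rewrite /= linearZl_LR.
Qed.
Let eval_cat P (b : {bilinear N -> M -> P}) u v :
  eval b (u ++ v) = eval b u + eval b v.
Proof. by rewrite /eval big_cat. Qed.

Let tzero : tensor := \pi_tensor [::].
Let tadd (s t : tensor) : tensor := \pi_tensor (repr s ++ repr t : formal).
Let tscale (a : A) (t : tensor) : tensor := \pi_tensor (scal a (repr t) : formal).
Let topp := tscale (- 1).

Let teval0 P (b : {bilinear N -> M -> P}) : teval b tzero = 0.
Proof. by rewrite teval_pi /eval big_nil. Qed.
Let tevalD P (b : {bilinear N -> M -> P}) s t :
  teval b (tadd s t) = teval b s + teval b t.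
Proof. by rewrite teval_pi eval_cat. Qed.
Let tevalZ P (b : {bilinear N -> M -> P}) a t :
  teval b (tscale a t) = a *: teval b t.
Proof. by rewrite teval_pi eval_scal. Qed.

Let taddA : associative tadd.
Proof. by move=> r s t; apply: tensor_ext => P b; rewrite !tevalD addrA. Qed.
Let taddC : commutative tadd.
Proof. by move=> s t; apply: tensor_ext => P b; rewrite !tevalD addrC. Qed.
Let tadd0 : left_id tzero tadd.
Proof. by move=> t; apply: tensor_ext => P b; rewrite tevalD teval0 add0r. Qed.
Let taddN : left_inverse tzero topp tadd.
Proof.
move=> t; apply: tensor_ext => P b.
by rewrite tevalD tevalZ teval0 scaleN1r addNr.
Qed.
HB.instance Definition _ :=
  GRing.isZmodule.Build tensor taddA taddC tadd0 taddN.

Let tscaleA a b t : tscale a (tscale b t) = tscale (a * b) t.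
Proof. by apply: tensor_ext => P c; rewrite !tevalZ scalerA. Qed.
Let tscale1 : left_id 1 tscale.
Proof. by move=> t; apply: tensor_ext => P c; rewrite tevalZ scale1r. Qed.
Let tscaleDr : right_distributive tscale +%R.
Proof.
by move=> a s t; apply: tensor_ext => P c; rewrite !(tevalZ, tevalD) scalerDr.
Qed.
Let tscaleDl t : {morph tscale^~ t : a b / a + b}.
Proof.
by move=> a b; apply: tensor_ext => P c; rewrite !(tevalZ, tevalD) scalerDl.
Qed.
HB.instance Definition _ :=
  GRing.Zmodule_isLmodule.Build A tensor tscaleA tscale1 tscaleDr tscaleDl.

Definition tens (x : N) (y : M) : tensor := \pi_tensor ([:: (x, y)] : formal).

Let teval_tens P (b : {bilinear N -> M -> P}) x y : teval b (tens x y) = b x y.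
Proof. by rewrite teval_pi /eval big_seq1. Qed.

Fact tens_bilinear : bilinear_for *:%R *:%R tens.
Proof.
split=> [y a x x'|x a y y']; apply: tensor_ext => P b;
  by rewrite tevalD tevalZ !teval_tens ?linearPl ?linearPr.
Qed.
HB.instance Definition _ :=
  bilinear_isBilinear.Build A N M tensor *:%R *:%R tens tens_bilinear.

Lemma tensor_exists : is_tensor tens.
Proof.
move=> P b; exists (teval b); split.
  by split=> [a s t|x y]; rewrite ?teval_tens // tevalD tevalZ.
move=> g [g_lin gE]; apply/funext => t; rewrite -[t in RHS]reprK /teval.
have gD u v : g (u + v) = g u + g v by rewrite -[u]scale1r g_lin !scale1r.
have g0 : g 0 = 0 by apply: (addIr (g 0)); rewrite -gD !add0r.
elim: (repr t) => [|[x y] u IHu]; first by rewrite /eval big_nil; exact/esym.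
rewrite /eval big_cons /= -gE [X in _ + X]IHu -gD; congr g.
by apply: tensor_ext => Q c; rewrite tevalD teval_tens !teval_pi /eval big_cons.
Qed.

End TensorExists.

(* g below is f (x) id_M; N (x) M and N' (x) M exist by tensor_exists. *)
Definition flat (A : comNzRingType) (M : lmodType A) : Prop :=
  forall (N N' : lmodType A) (f : {linear N -> N'}), injective f ->
  forall (T T' : lmodType A) (t : {bilinear N -> M -> T})
    (t' : {bilinear N' -> M -> T'}),
    is_tensor t -> is_tensor t' ->
  forall g : {linear T -> T'}, (forall x y, g (t x y) = t' (f x) y) ->
    injective g.

Definition semiregular (A : comNzRingType) : Prop :=
  forall M : lmodType A,
    exists (F : lmodType A) (f : {linear M -> F}), flat F /\ injective f.

Section Ext.
Variable A : comNzRingType.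
Implicit Types M N P E : lmodType A.

Definition projective P : Prop :=
  forall M N (p : {linear M -> N}), range p = setT ->
  forall f : {linear P -> N}, exists g : {linear P -> M}, p \o g =1 f.

Record proj_resolution M := ProjResolution {
  res_mod :> nat -> lmodType A;
  res_d : forall i, {linear res_mod i.+1 -> res_mod i};
  res_aug : {linear res_mod 0 -> M};
  res_projective : forall i, projective (res_mod i);
  res_aug_surj : range res_aug = setT;
  res_exact0 : exact_at (res_d 0) res_aug;
  res_exactS : forall i, exact_at (res_d i.+1) (res_d i)
}.

(* Ext^1_A(M, E) = 0: the complex Hom_A(P_i, E) is exact at i = 1.  Its homology
   does not depend on the projective resolution P, and every module has one. *)
Definition ext1_zero M E : Prop :=
  forall (P : proj_resolution M) (f : {linear P 1 -> E}),
    (forall x, f (res_d P 1 x) = 0) ->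
    exists g : {linear P 0 -> E}, forall x, f x = g (res_d P 0 x).

Definition fp_injective E : Prop :=
  forall M, finitely_presented M -> ext1_zero M E.

End Ext.

Definition divisible (A : idomainType) (E : lmodType A) : Prop :=
  forall a : A, a != 0 -> forall e : E, exists f : E, a *: f = e.

Definition torsion (A : idomainType) (E : lmodType A) : Prop :=
  forall e : E, exists2 a : A, a != 0 & a *: e = 0.

Section Annihilators.
Variables (A : comNzRingType) (E : lmodType A).

Definition ann_mod (I : set A) : set E :=
  [set e | forall a, I a -> a *: e = 0].

Definition ann_ring (S : set E) : set A :=
  [set a | forall e, S e -> a *: e = 0].

Definition DAC1 : Prop :=
  forall I : submodClosed A^o, finitely_generated (submod I) ->
    ann_ring (ann_mod [set` I]) = [set` I].

Definition DAC2 : Prop :=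
  forall S : submodClosed E, finitely_generated (submod S) ->
    ann_mod (ann_ring [set` S]) = [set` S].

Definition DAC : Prop := DAC1 /\ DAC2.

Definition ann_elt (x : A) : {pred E} := fun e => x *: e == 0.

Fact ann_elt_submod x : submod_closed (ann_elt x).
Proof.
split=> [|a u v]; rewrite !unfold_in ?scaler0 // => /eqP xu /eqP xv.
by rewrite scalerDr scalerA mulrC -scalerA xu xv scaler0 addr0.
Qed.

HB.instance Definition _ x :=
  GRing.isSubmodClosed.Build A E (ann_elt x) (ann_elt_submod x).

End Annihilators.
Arguments ann_elt {A} E x.

(* Main.v *)
Require Import Defs.
From HB Require Import structures.
From mathcomp Require Import all_boot all_order all_algebra.
From mathcomp Require Import boolp classical_sets functions.

Set Implicit Arguments.
Unset Strict Implicit.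
Unset Printing Implicit Defensive.

Import GRing.Theory.
Local Open Scope ring_scope.
Local Open Scope quotient_scope.

(** Write R for the trivial extension of A by E. The whole proof goes through
one finite property of a ring, [dual_exact]: the row space of every matrix is
the left kernel of some matrix, that is, every finitely presented module
embeds in a free module of finite rank.

_Semi-regular is the same as dual exact._ If the cokernel of a matrix B embeds
in a flat module, the images of the basis vectors solve B x = 0 there; by
flatness x = C z with B C = 0, and C is the matrix wanted
([semiregular_dual_exact]). Conversely a dual exact ring is coherent, so its
reduced powers are flat. Every module M embeds in such a power: given an m in
M other than 0 and a finite list of linear relations holding in M, dual
exactness yields a function from M to the ring that respects these relations
and does not vanish at m, and these functions are glued along the filter of
finite lists of relations ([separating_functional], [dual_exact_semiregular]).
Both directions need flatness as a statement on linear equations, which is the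
classical equational criterion ([flat_eqn_flat], [eqn_flat_flat]).

_Dual exact is a condition on ideals._ A ring is dual exact as soon as it is
coherent and every finitely generated ideal is the annihilator of its
annihilator ([dual_exact_of_ideals]); dual exactness also makes every system B
x = b solvable when each relation between the rows of B holds for b
([dual_exact_solvable]).

_Reading the conditions on A and E._ When E is divisible, a finitely generated
ideal of R either lies in E, or contains E and is determined by a nonzero
ideal of A. Its annihilator is then computed by annihilators between A and E,
so that double annihilators in R become the two parts of the double
annihilator condition, and relations in R become relations in A and in E
together with the modules of elements of E killed by some x in A
([trivext_ann_closed], [trivext_fg_relations]). Torsion only serves to produce
elements of E from relations in A, and a line over a field, where E has one
generator, does as well. Conversely, testing dual exactness of R on the
elements (a, 0) and (0, e) gives each clause ([trivext_divisible] and the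
lemmas after it); an element e of E which is not torsion forces E = A e, and
then A is a field by divisibility ([trivext_torsion_or_line]). Solvability of
systems in R gives solvability in E, hence fp-injectivity
([trivext_mx_injective], [mx_injective_fp]), and an fp-injective module is
divisible ([fp_injective_divisible]), which is why the two forms of the
theorem agree. *)

(** * Submodules, quotients and maps given by properties *)

Section Packing.
Variable R : comNzRingType.
Implicit Types U V W : lmodType R.

Definition submod_prop V (P : V -> Prop) : Prop :=
  P 0 /\ forall a u v, P u -> P v -> P (a *: u + v).

(** This lemma and the two after it turn bare properties into the bundled
structures over which the definitions of flatness and coherence quantify. *)
Lemma submod_of_prop V (P : V -> Prop) : submod_prop P ->
  exists S : submodClosed V, forall v, v \in S <-> P v.
Proof.
move=> [P0 PD]; pose p : {pred V} := fun v => `[< P v >].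
have p_closed : submod_closed p.
  split=> [|a u v]; first exact/asboolP.
  by move=> /asboolP Pu /asboolP Pv; apply/asboolP/PD.
pose S : submodClosed V :=
  HB.pack p (GRing.isSubmodClosed.Build R V p p_closed).
by exists S => v; split=> /asboolP.
Qed.

Lemma linear_of_prop U V (f : U -> V) :
  (forall a u v, f (a *: u + v) = a *: f u + f v) ->
  exists g : {linear U -> V}, forall u, g u = f u.
Proof.
move=> f_lin; have lin : linear f by move=> a u v; exact: f_lin.
pose g : {linear U -> V} := HB.pack f (GRing.isLinear.Build R U V *:%R f lin).
by exists g.
Qed.

Lemma bilinear_of_prop U V W (f : U -> V -> W) :
  (forall y a u v, f (a *: u + v) y = a *: f u y + f v y) ->
  (forall x a u v, f x (a *: u + v) = a *: f x u + f x v) ->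
  exists b : {bilinear U -> V -> W}, forall x y, b x y = f x y.
Proof.
move=> fl fr; have bil : bilinear_for *:%R *:%R f.
  by split=> [y a u v|x a u v]; [exact: fl | exact: fr].
pose b : {bilinear U -> V -> W} :=
  HB.pack f (bilinear_isBilinear.Build R U V W *:%R *:%R f bil).
by exists b.
Qed.

End Packing.

Section QuotientModule.
Variables (R : comNzRingType) (V : lmodType R) (S : submodClosed V).

Fact submod_zmod_closed : zmod_closed (S : {pred V}).
Proof.
split=> [|u v uS vS]; first exact: rpred0.
by rewrite -scaleN1r rpredD // rpredZ.
Qed.
Definition submod_zmod : zmodClosed V :=
  HB.pack (S : {pred V})
    (GRing.isZmodClosed.Build V (S : {pred V}) submod_zmod_closed).

Definition quotmod : Type := Quotient.quot submod_zmod.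
HB.instance Definition _ := GRing.Zmodule.on quotmod.
HB.instance Definition _ := EqQuotient.on quotmod.

Let pi (v : V) : quotmod := \pi_(Quotient.quot submod_zmod) v.
Let piD u v : pi (u + v) = pi u + pi v.
Proof. exact: (Quotient.pi_add submod_zmod u v). Qed.
Let pi_eq u v : (pi u = pi v) <-> (u - v \in S).
Proof.
rewrite (_ : (u - v \in S) = (u - v \in submod_zmod)) // Quotient.idealrBE.
by split=> [/eqP|/eqP].
Qed.
Let pi_repr (q : quotmod) : exists v, pi v = q.
Proof. by exists (repr q); rewrite /pi reprK. Qed.

Let scale (a : R) (q : quotmod) : quotmod := pi (a *: repr q).
Let scale_pi a v : scale a (pi v) = pi (a *: v).
Proof.
by apply/pi_eq; rewrite -scalerBr rpredZ //; apply/pi_eq; rewrite /pi reprK.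
Qed.

Let scaleA a b q : scale a (scale b q) = scale (a * b) q.
Proof. by have [v <-] := pi_repr q; rewrite !scale_pi scalerA. Qed.
Let scale1 : left_id 1 scale.
Proof. by move=> q; have [v <-] := pi_repr q; rewrite scale_pi scale1r. Qed.
Let scaleDr : right_distributive scale +%R.
Proof.
move=> a p q; have [u <-] := pi_repr p; have [v <-] := pi_repr q.
by rewrite -piD !scale_pi scalerDr piD.
Qed.
Let scaleDl q : {morph scale^~ q : a b / a + b}.
Proof.
by move=> a b; have [v <-] := pi_repr q; rewrite !scale_pi scalerDl piD.
Qed.
HB.instance Definition _ :=
  GRing.Zmodule_isLmodule.Build R quotmod scaleA scale1 scaleDr scaleDl.

Lemma quotmod_proj : exists pi : {linear V -> quotmod},
  (forall q, exists v, pi v = q) /\ forall v, pi v = 0 <-> v \in S.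
Proof.
have [f fE] : exists f : {linear V -> quotmod}, forall v, f v = pi v.
  by apply: linear_of_prop => a u v; rewrite piD -scale_pi.
exists f; split=> [q|v]; first by have [v <-] := pi_repr q; exists v.
have := pi_eq v 0; rewrite subr0 -!fE raddf0.
exact.
Qed.

End QuotientModule.

Lemma quotient_by (R : comNzRingType) (V : lmodType R) (P : V -> Prop) :
  submod_prop P -> exists (Q : lmodType R) (pi : {linear V -> Q}),
    (forall q, exists v, pi v = q) /\ forall v, pi v = 0 <-> P v.
Proof.
move=> /submod_of_prop [S SP]; have [pi [pi_surj pi0]] := quotmod_proj S.
by exists (quotmod S), pi; split=> // v; rewrite pi0 SP.
Qed.

(** * Matrices acting on tuples of module elements *)

Section MatrixAction.
Variables (R : comNzRingType) (V : lmodType R).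

(** Tuples of elements of V are treated as columns, so that a system of linear
equations in V is written like a matrix equation over R. *)
Definition mxact m n (B : 'M[R]_(m, n)) (x : 'I_n -> V) : 'I_m -> V :=
  fun i => \sum_j B i j *: x j.

Local Notation "B ** x" := (mxact B x) (at level 40, left associativity).

Lemma mxactA m n p (B : 'M[R]_(m, n)) (C : 'M_(n, p)) x :
  (B *m C) ** x = B ** (C ** x).
Proof.
apply/funext => i; rewrite /mxact.
under eq_bigr do rewrite mxE scaler_suml.
rewrite exchange_big; apply: eq_bigr => j _ /=.
by rewrite scaler_sumr; apply: eq_bigr => k _; rewrite scalerA.
Qed.

Lemma mxactDl m n (B C : 'M[R]_(m, n)) x : (B + C) ** x = B ** x + C ** x.
Proof.
apply/funext => i; rewrite -[RHS]/((B ** x) i + (C ** x) i).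
rewrite /mxact -big_split /=.
by apply: eq_bigr => j _; rewrite mxE scalerDl.
Qed.

Lemma mxactZl m n a (B : 'M[R]_(m, n)) x : (a *: B) ** x = a *: (B ** x).
Proof.
apply/funext => i; rewrite -[RHS]/(a *: (B ** x) i) /mxact scaler_sumr.
by apply: eq_bigr => j _; rewrite mxE scalerA.
Qed.

Lemma mxactNl m n (B : 'M[R]_(m, n)) x : (- B) ** x = - (B ** x).
Proof. by rewrite -scaleN1r mxactZl scaleN1r. Qed.

Lemma mxactBl m n (B C : 'M[R]_(m, n)) x : (B - C) ** x = B ** x - C ** x.
Proof. by rewrite mxactDl mxactNl. Qed.

Lemma mxact0l m n x : (0 : 'M[R]_(m, n)) ** x = 0.
Proof. by rewrite -(scale0r 0) mxactZl scale0r. Qed.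

Lemma mxactZr m n a (B : 'M[R]_(m, n)) x : B ** (a *: x) = a *: (B ** x).
Proof.
apply/funext => i; rewrite -[RHS]/(a *: (B ** x) i) /mxact scaler_sumr.
by apply: eq_bigr => j _; rewrite !scalerA mulrC.
Qed.

Lemma mxact0r m n (B : 'M[R]_(m, n)) : B ** 0 = 0.
Proof. by rewrite -(scale0r 0) mxactZr scale0r. Qed.

Lemma mxact1 n (x : 'I_n -> V) : 1%:M ** x = x.
Proof.
apply/funext => i; rewrite /mxact (bigD1 i) //= mxE eqxx scale1r.
by rewrite big1 ?addr0 // => j ji; rewrite mxE eq_sym (negPf ji) scale0r.
Qed.

Lemma mxact_row m n (B : 'M[R]_(m, n)) x i : (row i B) ** x = cst ((B ** x) i).
Proof.
by apply/funext => k; rewrite /mxact /cst; apply: eq_bigr => j _; rewrite mxE.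
Qed.

Lemma mxact_delta_row n (x : 'I_n -> V) i : 
  (delta_mx 0 i : 'rV_n) ** x = cst (x i).
Proof. by rewrite -row1 mxact_row mxact1. Qed.

Lemma mxact_rowP m n (B : 'M[R]_(m, n)) x :
  (forall i, row i B ** x = 0) -> B ** x = 0.
Proof.
move=> Bx0; apply/funext => i.
by have /(congr1 (@^~ 0)) := Bx0 i; rewrite mxact_row.
Qed.

Definition tcat m n (x : 'I_m -> V) (y : 'I_n -> V) : 'I_(m + n) -> V :=
  fun i => match fintype.split i with inl j => x j | inr k => y k end.

Lemma tcat0 m n : tcat (0 : 'I_m -> V) (0 : 'I_n -> V) = 0.
Proof. by apply/funext => i; rewrite /tcat; case: (fintype.split i). Qed.

Lemma mxact_col_mx m1 m2 n (B : 'M[R]_(m1, n)) (C : 'M_(m2, n)) x :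
  col_mx B C ** x = tcat (B ** x) (C ** x).
Proof.
apply/funext => i; rewrite -(fintype.splitK i) /tcat fintype.unsplitK /mxact.
by case: (fintype.split i) => j /=;
  under eq_bigr do rewrite ?col_mxEu ?col_mxEd.
Qed.

Lemma mxact_row_mx k m n (B : 'M[R]_(k, m)) (C : 'M_(k, n)) x y :
  row_mx B C ** tcat x y = B ** x + C ** y.
Proof.
apply/funext => i; rewrite -[RHS]/((B ** x) i + (C ** y) i) /mxact.
rewrite big_split_ord /=.
congr (_ + _); apply: eq_bigr => j _; rewrite ?row_mxEl ?row_mxEr /tcat.
  by rewrite -[lshift n j]/(unsplit (inl j)) fintype.unsplitK.
by rewrite -[rshift m j]/(unsplit (inr j)) fintype.unsplitK.
Qed.

End MatrixAction.

Notation "B ** x" := (mxact B x) (at level 40, left associativity) : ring_scope.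

Lemma linear_mxact (R : comNzRingType) (U V : lmodType R) (f : {linear U -> V})
    m n (B : 'M[R]_(m, n)) (x : 'I_n -> U) i :
  f ((B ** x) i) = (B ** (f \o x)) i.
Proof.
by rewrite /mxact linear_sum; apply: eq_bigr => j _; rewrite linearZ_LR.
Qed.

Lemma mxact_col (R : comNzRingType) m n (B : 'M[R]_(m, n)) (x : 'I_n -> R^o) i :
  (B ** x) i = (B *m \col_j x j) i 0.
Proof. by rewrite mxE; apply: eq_bigr => j _; rewrite mxE. Qed.

(** * Finiteness and injectivity conditions in terms of matrices *)

Section Conditions.
Variable R : comNzRingType.

(** Exactness in the middle of y |-> y B, y |-> y C on row vectors. *)
Definition mx_exact m n k (B : 'M[R]_(m, n)) (C : 'M_(n, k)) : Prop :=
  forall y : 'rV_n, y *m C = 0 <-> exists x, y = x *m B.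

(** The cokernel of B embeds in a free module, through C. *)
Definition dual_exact : Prop :=
  forall m n (B : 'M[R]_(m, n)), exists k (C : 'M_(n, k)), mx_exact B C.

Definition mx_coherent : Prop :=
  forall n k (C : 'M[R]_(n, k)), exists m (B : 'M_(m, n)), mx_exact B C.

(** Double annihilators of finitely generated ideals. *)
Definition ann_closed : Prop :=
  forall m (a : 'I_m -> R) (b : R),
    (forall r, (forall i, r * a i = 0) -> r * b = 0) ->
    exists c : 'I_m -> R, b = \sum_i c i * a i.

Variable V : lmodType R.

Definition fg_relations : Prop :=
  forall m (e : 'I_m -> V), exists k (D : 'M[R]_(k, m)),
    forall y : 'rV_m, y ** e = 0 <-> exists x, y = x *m D.

(** Vanishing of Ext^1(coker B, V), read on the presentation B: a linear map
from the row space of B to V, given by b, extends to the whole free module. *)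
Definition mx_injective : Prop :=
  forall m n (B : 'M[R]_(m, n)) (b : 'I_m -> V),
    (forall y : 'rV_m, y *m B = 0 -> y ** b = 0) ->
    exists x : 'I_n -> V, b = B ** x.

Definition eqn_flat : Prop :=
  forall m n (B : 'M[R]_(m, n)) (x : 'I_n -> V), B ** x = 0 ->
    exists p (D : 'M_(n, p)) (z : 'I_p -> V), B *m D = 0 /\ x = D ** z.

End Conditions.

Lemma mx_exact_mul0 (R : comNzRingType) m n k (B : 'M[R]_(m, n))
    (C : 'M_(n, k)) : mx_exact B C -> B *m C = 0.
Proof.
move=> BC; apply/row_matrixP => i; rewrite row_mul row0; apply/BC.
by exists (delta_mx 0 i); rewrite -rowE.
Qed.

Lemma mx_exactP (R : comNzRingType) m n k (B : 'M[R]_(m, n)) (C : 'M_(n, k)) p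
    (Y : 'M_(p, n)) : mx_exact B C -> Y *m C = 0 -> exists X, Y = X *m B.
Proof.
move=> BC YC; have rowP i : exists x, row i Y = x *m B.
  by apply/BC; rewrite -row_mul YC row0.
have [X XP] := choice rowP; exists (\matrix_i X i).
by apply/row_matrixP => i; rewrite row_mul rowK.
Qed.

(** * Flatness in terms of linear equations *)

Section FlatEquations.
Variable R : comNzRingType.

(** Let N be the column space of B inside the free module N' of columns.
Because B x = 0, the element of N (x) V which pairs the j-th column of B with
x_j vanishes in N' (x) V, so by flatness it vanishes in N (x) V. The bilinear
map from N x V to V^n modulo solutions of the form D z with B D = 0 then sends
it to the class of x, which is therefore 0. *)
Lemma flat_eqn_flat (V : lmodType R) : flat V -> eqn_flat V.
Proof.
move=> V_flat m n B x Bx0.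
have [S SP] : exists S : submodClosed 'cV[R]_m,
    forall v, v \in S <-> exists c : 'cV_n, v = B *m c.
  apply: submod_of_prop; split=> [|a u v [c ->] [d ->]].
    by exists 0; rewrite mulmx0.
  by exists (a *: c + d); rewrite mulmxDr scalemxAr.
pose N : lmodType R := submod S.
have [f fE] : exists f : {linear N -> 'cV[R]_m}, forall v, f v = submod_val v.
  by apply: linear_of_prop.
have f_inj : injective f by move=> u v; rewrite !fE => /val_inj.
have [b bE] : exists b : {bilinear N -> V -> tensor 'cV[R]_m V},
    forall v y, b v y = tens (f v) y.
  apply: bilinear_of_prop => [y a u v|v a y y'].
    by rewrite linearP linearPl.
  by rewrite linearPr.
have [g0 [[g0_lin g0E] _]] := tensor_exists b.
have [g gE] := linear_of_prop g0_lin.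
have g_inj : injective g.
  apply: (V_flat _ _ f f_inj _ _ (@tens R N V) (@tens R 'cV_m V)).
  - exact: tensor_exists.
  - exact: tensor_exists.
  - by move=> v y; rewrite gE g0E bE.
have colS j : col j B \in S by apply/SP; exists (delta_mx j 0); rewrite -colE.
pose v j : N := SubMod (colS j).
have v0 : \sum_j tens (v j) (x j) = 0.
  apply: g_inj; rewrite linear_sum linear0.
  transitivity (\sum_j \sum_i tens (delta_mx i 0 : 'cV[R]_m) (B i j *: x j)).
    apply: eq_bigr => j _; rewrite gE g0E bE fE /=.
    rewrite [col j B]matrix_sum_delta linear_sumlz; apply: eq_bigr => i _.
    by rewrite big_ord1 linearZl_LR linearZr_LR mxE.
  rewrite exchange_big big1 // => i _; rewrite -linear_sumr.
  by have := congr1 (@^~ i) Bx0; rewrite /mxact /= => ->; rewrite linear0r.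
(* A column of N is a combination of columns of B; its coefficients are unique
   up to the kernel of B, and dividing by K removes that ambiguity. *)
pose K (y : 'I_n -> V) := exists p (D : 'M_(n, p)) (z : 'I_p -> V),
  B *m D = 0 /\ y = D ** z.
have [P [pi [_ pi0]]] : exists (P : lmodType R) (pi : {linear ('I_n -> V) -> P}),
    (forall q, exists y, pi y = q) /\ forall y, pi y = 0 <-> K y.
  apply: quotient_by; split=> [|a y y' [p [D [z [BD ->]]]] [q [D' [z' [BD' ->]]]]].
    by exists 0, 0, 0; rewrite mulmx0 mxact0l.
  exists (p + q)%N, (row_mx D D'), (tcat (a *: z) z').
  by rewrite mul_mx_row BD BD' row_mx0 mxact_row_mx mxactZr.
have /choice[c cE] (u : N) : exists d : 'cV_n, submod_val u = B *m d.
  by case: u => u uS; apply/SP.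
have pi_ker (d d' : 'cV_n) y : B *m d = B *m d' ->
    pi (fun j => d j 0 *: y) = pi (fun j => d' j 0 *: y).
  move=> dd'; apply/eqP; rewrite -subr_eq0 -raddfB; apply/eqP/pi0.
  exists 1, (d - d'), (cst y); rewrite mulmxBr dd' subrr; split=> //.
  apply/funext => j; rewrite /mxact big_ord1 !mxE scalerBl //.
have [h hE] : exists h : {bilinear N -> V -> P},
    forall u y, h u y = pi (fun j => c u j 0 *: y).
  apply: bilinear_of_prop => [y a u u'|u a y y'].
    rewrite -linearP; rewrite (pi_ker _ (a *: c u + c u')).
      apply: (congr1 pi); apply/funext => j.
      by rewrite !mxE scalerDl -scalerA.
    by rewrite -cE mulmxDr -scalemxAr -!cE.
  rewrite -linearP; apply: (congr1 pi); apply/funext => j.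
  by rewrite scalerDr scalerA mulrC -scalerA.
have [k [[k_lin kE] _]] := tensor_exists h.
have [l lE] := linear_of_prop k_lin.
apply/pi0; transitivity (l (\sum_j tens (v j) (x j))); last by rewrite v0 raddf0.
rewrite linear_sum -[x in pi x]mxact1.
transitivity (\sum_j pi (fun i => delta_mx j (0 : 'I_1) i 0 *: x j)).
  rewrite -linear_sum; apply: (congr1 pi); apply/funext => i.
  rewrite fct_sumE /mxact; apply: eq_bigr => j _.
  by rewrite !mxE andbT.
apply: eq_bigr => j _; rewrite lE kE hE; apply: pi_ker.
by rewrite -cE /= colE.
Qed.

End FlatEquations.

Section TensorVanishing.
Variables (R : comNzRingType) (N V : lmodType R).

(** The elementary reason why the sum of x_i (x) y_i vanishes: the y_i are
combinations of some w_k for which all the coefficients in N cancel. *)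
Definition tensor_null n (y : 'I_n -> V) (x : 'I_n -> N) : Prop :=
  exists p (A : 'M[R]_(n, p)) (w : 'I_p -> V), y = A ** w /\ A^T ** x = 0.

Lemma tensor_null_tcat m n (y : 'I_m -> V) x (y' : 'I_n -> V) x' :
  tensor_null y x -> tensor_null y' x' -> tensor_null (tcat y y') (tcat x x').
Proof.
move=> [p [A [w [-> Ax]]]] [q [B [z [-> Bx]]]].
exists (p + q)%N, (block_mx A 0 0 B), (tcat w z); split.
  by rewrite mxact_col_mx !mxact_row_mx !mxact0l addr0 add0r.
rewrite tr_block_mx !trmx0 mxact_col_mx !mxact_row_mx !mxact0l addr0 add0r.
by rewrite Ax Bx tcat0.
Qed.

Lemma tensor_null_mxact m n (M : 'M[R]_(m, n)) y x :
  tensor_null y (M^T ** x) -> tensor_null (M ** y) x.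
Proof.
move=> [p [A [w [-> AMx]]]]; exists p, (M *m A), w; split.
  by rewrite mxactA.
by rewrite trmx_mul mxactA.
Qed.

(** This is where flatness enters. The two ways of writing M y, as M applied
to y and as A applied to w, give a linear equation in V; flatness refines y
and w to a common tuple z on which the two coefficient matrices agree. *)
Lemma tensor_null_tr m n (M : 'M[R]_(m, n)) y x : eqn_flat V ->
  tensor_null (M ** y) x -> tensor_null y (M^T ** x).
Proof.
move=> V_flat [p [A [w [MyAw Ax]]]].
have /V_flat[q [D [z [DE DzE]]]] : row_mx M (- A) ** tcat y w = 0.
  by rewrite mxact_row_mx mxactNl MyAw subrr.
have MD : M *m usubmx D = A *m dsubmx D.
  apply/eqP; rewrite -subr_eq0 -mulNmx -mul_row_col vsubmxK; exact/eqP.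
exists q, (usubmx D), z; split.
  apply/funext => i; have := congr1 (@^~ (lshift p i)) DzE.
  rewrite -[D in RHS]vsubmxK mxact_col_mx.
  by rewrite /tcat -[lshift p i]/(unsplit (inl i)) fintype.unsplitK.
by rewrite -mxactA -trmx_mul MD trmx_mul mxactA Ax mxact0r.
Qed.

(** N (x) V is modelled as finitely supported functions from V to N, with x
(x) y the function carrying the value x at y. *)
Definition tensor_point (x : N) (y : V) : V -> N := fun v => (v == y)%:R *: x.

(** Two formal sums with the same underlying function are both obtained from
one tuple v without repetitions, by 0-1 matrices; so nullity can be moved from
one to the other through v. *)
Lemma tensor_null_point m n (y : 'I_m -> V) x (y' : 'I_n -> V) x' :
  eqn_flat V ->
  \sum_i tensor_point (x i) (y i) = \sum_i tensor_point (x' i) (y' i) ->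
  tensor_null y x -> tensor_null y' x'.
Proof.
move=> V_flat xx'; pose s := undup (codom y ++ codom y').
pose v (l : 'I_(size s)) := nth 0 s l.
pose ind k (z : 'I_k -> V) : 'M[R]_(k, size s) := \matrix_(i, l) (v l == z i)%:R.
have indK k (z : 'I_k -> V) : (forall i, z i \in s) -> z = ind k z ** v.
  move=> zs; apply/funext => i; have zi := zs i; rewrite -index_mem in zi.
  rewrite /mxact (bigD1 (Ordinal zi)) //= mxE /v nth_index // eqxx scale1r.
  rewrite big1 ?addr0 // => l; rewrite mxE -val_eqE /= => li.
  case: eqP => [lE|]; last by rewrite scale0r.
  by move: li; rewrite -lE index_uniq ?undup_uniq ?eqxx.
have indT k (z : 'I_k -> V) u l :
    ((ind k z)^T ** u) l = (\sum_i tensor_point (u i) (z i)) (v l).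
  by rewrite /mxact fct_sumE; apply: eq_bigr => i _; rewrite !mxE.
have y_s i : y i \in s by rewrite mem_undup mem_cat codom_f.
have y'_s i : y' i \in s by rewrite mem_undup mem_cat codom_f orbT.
rewrite (indK _ y) // (indK _ y') // => /(tensor_null_tr V_flat) vx.
apply: tensor_null_mxact; congr (tensor_null _ _): vx.
by apply/funext => l; rewrite !indT xx'.
Qed.

(** The elements of N (x) V that vanish for an elementary reason form a
submodule, and by [tensor_null_point] the reason applies to every way of
writing them; so the quotient by it is the target of a bilinear map under
which vanishing has an elementary reason. *)
Lemma tensor_model : eqn_flat V ->
  exists (P : lmodType R) (b : {bilinear N -> V -> P}),
  forall n (x : 'I_n -> N) y, \sum_i b (x i) (y i) = 0 -> tensor_null y x.
Proof.
move=> V_flat; pose K (h : V -> N) := exists n (y : 'I_n -> V) (x : 'I_n -> N),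
  h = \sum_i tensor_point (x i) (y i) /\ tensor_null y x.
have [P [pi [_ pi0]]] : exists (P : lmodType R) (pi : {linear (V -> N) -> P}),
    (forall q, exists h, pi h = q) /\ forall h, pi h = 0 <-> K h.
  apply: quotient_by; split=> [|a h h' [m [y [x [-> yx]]]] [n [y' [x' [-> yx']]]]].
    exists 0, 0, 0; split; first by rewrite big_ord0.
    by exists 0, 0, 0; rewrite mxact0l mxact0r.
  exists (m + n)%N, (tcat y y'), (tcat (a *: x) x'); split.
    rewrite big_split_ord /= scaler_sumr; congr (_ + _); apply: eq_bigr => i _.
      rewrite /tcat -[lshift n i]/(unsplit (inl i)) fintype.unsplitK.
      by apply/funext => v; rewrite /tensor_point scalerA mulrC -scalerA.
    by rewrite /tcat -[rshift m i]/(unsplit (inr i)) fintype.unsplitK.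
  apply: tensor_null_tcat => //; have [p [A [w [-> Ax]]]] := yx.
  by exists p, A, w; rewrite mxactZr Ax scaler0.
have [b bE] : exists b : {bilinear N -> V -> P},
    forall x y, b x y = pi (tensor_point x y).
  apply: bilinear_of_prop => [y a u v|x a y y'].
    rewrite -linearP; apply: (congr1 pi); apply/funext => z.
    by rewrite /tensor_point scalerDr scalerA mulrC -scalerA.
  apply/eqP; rewrite -linearP -subr_eq0 -linearB; apply/eqP/pi0.
  exists 3, (fun i => nth 0 [:: a *: y + y'; y; y'] i).
  exists (fun i => nth 0 [:: x; - (a *: x); - x] i); split.
    rewrite !big_ord_recl big_ord0 /= addr0; apply/funext => v.
    rewrite -[RHS]/(tensor_point _ _ v + (tensor_point _ _ v + tensor_point _ _ v)).
    rewrite -[LHS]/(tensor_point _ _ v - (a *: tensor_point x y v + _)).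
    by rewrite /tensor_point /= opprD !scalerN !scalerA mulrC.
  (* The three points a y + y', y, y' are combinations of y and y', and the
     coefficients a x - a x and x - x cancel. *)
  exists 2, (\matrix_(i, j) nth 0 (nth [::] [:: [:: a; 1]; [:: 1]; [:: 0; 1]] i) j).
  exists (fun j => nth 0 [:: y; y'] j).
  split; apply/funext => -[[|[|[|i]]] lti] //;
    rewrite /mxact !big_ord_recl big_ord0 !mxE /= ?addr0;
    by rewrite ?(scale1r, scale0r, addr0, add0r, scalerN) ?subrr.
exists P, b => n x y; under eq_bigr do rewrite bE.
rewrite -linear_sum => /pi0[m [z [u [xz zu]]]].
exact: tensor_null_point zu.
Qed.

End TensorVanishing.

Section FlatOfEquations.
Variable R : comNzRingType.

(** The quotient of T by the elements of this form receives two linear maps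
from T that agree on pure tensors, the projection and 0; uniqueness in the
universal property identifies them. *)
Lemma tensor_span (N V T : lmodType R) (t : {bilinear N -> V -> T}) :
  is_tensor t -> forall z : T, exists n (x : 'I_n -> N) (y : 'I_n -> V),
    z = \sum_i t (x i) (y i).
Proof.
move=> tT; pose K (z : T) := exists n (x : 'I_n -> N) (y : 'I_n -> V),
  z = \sum_i t (x i) (y i).
have [P [pi [_ pi0]]] : exists (P : lmodType R) (pi : {linear T -> P}),
    (forall q, exists h, pi h = q) /\ forall h, pi h = 0 <-> K h.
  apply: quotient_by; split=> [|a _ _ [m [x [y ->]]] [n [x' [y' ->]]]].
    by exists 0, 0, 0; rewrite big_ord0.
  exists (m + n)%N, (tcat (a *: x) x'), (tcat y y').
  rewrite big_split_ord /= scaler_sumr; congr (_ + _); apply: eq_bigr => i _.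
    rewrite /tcat -[lshift n i]/(unsplit (inl i)) fintype.unsplitK.
    by rewrite -linearZl_LR.
  by rewrite /tcat -[rshift m i]/(unsplit (inr i)) fintype.unsplitK.
have [b bE] : exists b : {bilinear N -> V -> P}, forall x y, b x y = 0.
  by apply: bilinear_of_prop => *; rewrite scaler0 addr0.
have [g [_ g_uniq]] := tT P b.
have g0 : g = fun=> 0.
  by apply: g_uniq; split=> [a u v|x y]; rewrite ?bE // scaler0 addr0.
have gpi : g = pi.
  apply: g_uniq; split=> [a u v|x y]; first by rewrite linearP.
  rewrite bE; apply/pi0; exists 1, (cst x), (cst y).
  by rewrite big_ord1.
by move=> z; apply/pi0; rewrite -gpi g0.
Qed.

(** A combination of the f x_i vanishing in N' (x) V does so for the
elementary reason of [tensor_null]; since f is injective, the same reason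
holds for the x_i in N. *)
Lemma eqn_flat_flat (V : lmodType R) : eqn_flat V -> flat V.
Proof.
move=> V_flat N N' f f_inj T T' t t' tT tT' g gE.
suff ker0 z : g z = 0 -> z = 0.
  move=> u v guv; apply/eqP; rewrite -subr_eq0; apply/eqP/ker0.
  by rewrite linearB guv subrr.
have [n [x [y ->]]] := tensor_span tT z.
rewrite linear_sum; under eq_bigr do rewrite gE.
have [P [b bP]] := @tensor_model R N' V V_flat.
have [h [[h_lin hE] _]] := tT' P b; have [k kE] := linear_of_prop h_lin.
move=> /(congr1 k); rewrite linear_sum linear0.
under eq_bigr do rewrite kE hE.
move=> /bP[p [A [w [yE fx]]]].
have Ax : A^T ** x = 0.
  apply/funext => j; apply: f_inj; rewrite linear_mxact.
  by have /(congr1 (@^~ j)) := fx; rewrite linear0.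
transitivity (\sum_j t ((A^T ** x) j) (w j)); last first.
  by rewrite big1 // => j _; rewrite Ax linear0l.
rewrite yE /mxact; under eq_bigr do rewrite linear_sumr.
rewrite exchange_big; apply: eq_bigr => j _; rewrite linear_sumlz.
by apply: eq_bigr => i _; rewrite mxE linearZl_LR linearZr_LR.
Qed.

End FlatOfEquations.

(** * Rings whose finitely presented modules embed in free modules *)

Section DualExact.
Variable R : comNzRingType.

(** Dualise twice. If the row space of C^T is the kernel of D and that of D^T
the kernel of F, then D^T F = 0 forces F^T to be a multiple of C^T, so
whatever is killed by C is killed by F and is a combination of the rows of
D^T. *)
Lemma dual_exact_coherent : dual_exact R -> mx_coherent R.
Proof.
move=> R_dual n k C; have [p [D CD]] := R_dual _ _ C^T.
exists p, D^T => y; split=> [yC|[x ->]]; last first.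
  by rewrite -mulmxA -[C]trmxK -trmx_mul (mx_exact_mul0 CD) trmx0 mulmx0.
have [q [F DF]] := R_dual _ _ D^T; apply/DF.
have /(mx_exactP CD)[X FX] : F^T *m D = 0.
  by rewrite -[D]trmxK -trmx_mul (mx_exact_mul0 DF) trmx0.
by rewrite -[F]trmxK FX trmx_mul trmxK mulmxA yC mul0mx.
Qed.

(** The columns of B are the kernel of some C^T, and the hypothesis applied to
the rows of C^T says that b lies in that kernel. *)
Lemma dual_exact_solvable m n (B : 'M[R]_(m, n)) (b : 'cV_m) : dual_exact R ->
  (forall y : 'rV_m, y *m B = 0 -> y *m b = 0) -> exists x, b = B *m x.
Proof.
move=> R_dual Bb; have [k [C BC]] := R_dual _ _ B^T.
have CB : C^T *m B = 0.
  by rewrite -[B]trmxK -trmx_mul (mx_exact_mul0 BC) trmx0.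
have /BC[x bx] : b^T *m C = 0.
  apply: trmx_inj; rewrite trmx_mul trmxK trmx0; apply/row_matrixP => i.
  by rewrite row_mul row0; apply: Bb; rewrite -row_mul CB row0.
by exists x^T; rewrite -[b]trmxK bx trmx_mul trmxK.
Qed.

Lemma dual_exact_ann_closed : dual_exact R -> ann_closed R.
Proof.
move=> R_dual m a b ab.
have [|x bx] := @dual_exact_solvable 1 m (\row_i a i) (\col__ b) R_dual.
  move=> y ya; apply/matrixP=> i j.
  rewrite ord1 mxE big_ord1 !mxE ord1; apply: ab => k.
  by have /matrixP/(_ 0 k) := ya; rewrite mxE big_ord1 !mxE.
exists (fun i => x i 0); have /matrixP/(_ 0 0) := bx; rewrite !mxE => ->.
by apply: eq_bigr => i _; rewrite !mxE mulrC.
Qed.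

(** A kernel is cut out one column at a time: relations on the first column
are generated by some D, and those among them that kill the other columns are
given by relations on D C1. *)
Lemma fg_relations_mx_coherent : fg_relations R^o -> mx_coherent R.
Proof.
move=> R_coh n k C; elim: k n C => [|k IHk] n C.
  exists n, 1%:M => y; split=> _; last by rewrite [LHS]thinmx0.
  by exists y; rewrite mulmx1.
rewrite -[C](@hsubmxK _ n 1 k); set c := lsubmx _; set C1 := rsubmx _.
have [p [D cD]] := R_coh _ (fun i => c i 0 : R^o).
have cDm : mx_exact D c.
  have cE : \col_j c j 0 = c by apply/matrixP => i j; rewrite mxE ord1.
  move=> y; rewrite -cD; split=> yc.
    by apply/funext => i; rewrite mxact_col cE yc mxE.
  apply/matrixP => i j; have := congr1 (@^~ i) yc.
  by rewrite mxact_col cE !ord1 => ->; rewrite mxE.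
have [q [F FD]] := IHk _ (D *m C1).
exists q, (F *m D) => y; rewrite (mul_mx_row y c C1); split=> [|[x ->]].
  rewrite -[0](@row_mx0 _ 1 1 k) => ycC.
  have [/cDm[x ->]] := @eq_row_mx _ 1 1 k _ _ _ _ ycC.
  by rewrite -mulmxA => /FD[z ->]; exists z; rewrite mulmxA.
rewrite -!mulmxA (mx_exact_mul0 FD) (mx_exact_mul0 cDm).
by rewrite !mulmx0 row_mx0.
Qed.

(** A map from the ideal generated by the entries of a to the ring is the
multiplication by one element r. By induction r is correct on the entries of
a1, and the defect beta at the other generator alpha is killed by every t such
that t alpha lies in the ideal I of the entries of a1. As I is its own double
annihilator, these t are the annihilator of alpha Ann(I), which is a finitely
generated ideal because the ring is coherent; so beta lies in it, and r can be
corrected by an element of Ann(I). *)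
Lemma col_solvable m (a b : 'cV[R]_m) : mx_coherent R -> ann_closed R ->
  (forall y : 'rV_m, y *m a = 0 -> y *m b = 0) -> exists r, b = r *: a.
Proof.
move=> R_coh R_ann; elim: m a b => [|m IHm] a b.
  by exists 0; rewrite [RHS]flatmx0 [LHS]flatmx0.
rewrite -[a](@vsubmxK _ 1 m 1 a) -[b](@vsubmxK _ 1 m 1 b).
set a0 := @usubmx _ 1 m 1 a; set a1 := @dsubmx _ 1 m 1 a.
set b0 := @usubmx _ 1 m 1 b; set b1 := @dsubmx _ 1 m 1 b.
move=> ab.
have {}ab (u : 'rV_1) (y : 'rV_m) :
    u *m a0 + y *m a1 = 0 -> u *m b0 + y *m b1 = 0.
  by rewrite -!mul_row_col; apply: (ab (row_mx u y)).
move: a0 a1 b0 b1 ab => a0 a1 b0 b1 ab.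
have [y ya|r b1E] := IHm a1 b1.
  by have := ab 0 y; rewrite !mul0mx !add0r; apply.
pose alpha := a0 0 0; pose beta := b0 0 0 - r * alpha.
have beta_ann s (y : 'rV_m) : s%:M = y *m a1 -> forall t, s = t * alpha ->
    t * beta = 0.
  move=> sE t st; have := ab t%:M (- y).
  have a0E : a0 = alpha%:M by rewrite [LHS]mx11_scalar.
  have b0E : b0 = (b0 0 0)%:M by rewrite [LHS]mx11_scalar.
  rewrite a0E b0E b1E -!scalar_mxM !mulNmx -scalemxAr -sE st subrr.
  move=> /(_ erefl) /matrixP/(_ 0 0); rewrite !mxE !mulr1n /beta mulrBr => <-.
  by rewrite [in RHS]mulrCA.
have [k [D Da1]] := R_coh 1%N m a1^T.
have [|c betaE] := R_ann k (fun l => alpha * D l 0) beta.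
  move=> t tD; have [|y ya] := R_ann m (fun i => a1 i 0) (t * alpha).
    move=> u ua; have /Da1[x uE] : u%:M *m a1^T = 0.
      by apply/matrixP => i j; rewrite ord1 mul_scalar_mx !mxE ua.
    have := congr1 (fun M : 'M_1 => M 0 0) uE; rewrite !mxE mulr1n => ->.
    rewrite mulr_suml big1 // => l _.
    by rewrite -mulrA [D l 0 * _]mulrC -mulrA tD mulr0.
  apply: (beta_ann (t * alpha) (\row_i y i)) => //.
  apply/matrixP => i j; rewrite !ord1 ya !mxE mulr1n.
  by apply: eq_bigr => l _; rewrite mxE.
pose d := \sum_i c i * D i 0.
have da1 : d *: a1 = 0.
  have := mx_exact_mul0 Da1 => Da0; apply/matrixP => i j; rewrite ord1 !mxE.
  rewrite mulr_suml big1 // => l _; have /matrixP/(_ l i) := Da0.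
  by rewrite !mxE big_ord1 mxE -mulrA => ->; rewrite mulr0.
have b0E : b0 = (r + d) *: a0.
  rewrite [b0]mx11_scalar [a0]mx11_scalar -/alpha scale_scalar_mx.
  congr _%:M; rewrite mulrDl -[LHS](subrK (r * alpha)) -/beta betaE addrC.
  congr (_ + _); rewrite mulr_suml; apply: eq_bigr => l _.
  by rewrite -mulrA [D l 0 * _]mulrC.
exists (r + d); rewrite (scale_col_mx (r + d) a0 a1) b0E.
by rewrite [in (r + d) *: a1]scalerDl da1 addr0 b1E.
Qed.

(** Induction on the columns of B. The rows of D generate the relations on the
first column c, so solving D B1 x = D b leaves a defect b - B1 x compatible
with every relation on c, and the case of one column applies. *)
Lemma mx_solvable m n (B : 'M[R]_(m, n)) (b : 'cV_m) :
  mx_coherent R -> ann_closed R ->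
  (forall y : 'rV_m, y *m B = 0 -> y *m b = 0) -> exists x, b = B *m x.
Proof.
move=> R_coh R_ann; elim: n m B b => [|n IHn] m B b.
  move=> Bb; exists 0; rewrite mulmx0 -[b]mul1mx; apply/row_matrixP => i.
  by rewrite row_mul row0; apply: Bb; rewrite [LHS]thinmx0.
rewrite -[B](@hsubmxK _ m 1 n); set c := @lsubmx _ m 1 n B.
set B1 := @rsubmx _ m 1 n B => Bb.
have {}Bb (y : 'rV_m) : y *m c = 0 -> y *m B1 = 0 -> y *m b = 0.
  move=> yc yB1; apply: Bb; rewrite (mul_mx_row y c B1) yc yB1.
  exact: (@row_mx0 _ 1 1 n).
have [k [D Dc]] := R_coh _ _ c.
have [y yDB|x1 DbE] := IHn _ (D *m B1) (D *m b).
  rewrite mulmxA; apply: Bb; rewrite -mulmxA //.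
  by rewrite (mx_exact_mul0 Dc) mulmx0.
have [y /Dc[x ->]|r bE] := @col_solvable m c (b - B1 *m x1) R_coh R_ann.
  by rewrite mulmxBr -mulmxA DbE -!mulmxA subrr.
exists (col_mx r%:M x1); rewrite (mul_row_col c B1 r%:M x1) mul_mx_scalar.
by rewrite -bE subrK.
Qed.

Lemma dual_exact_of_ideals : fg_relations R^o -> ann_closed R -> dual_exact R.
Proof.
move=> /fg_relations_mx_coherent R_coh R_ann m n B.
have [k [D DB]] := R_coh _ _ B^T.
exists k, D^T => y; split=> [yD|[x ->]]; last first.
  apply: trmx_inj; rewrite !trmx_mul trmxK mulmxA (mx_exact_mul0 DB).
  by rewrite mul0mx trmx0.
have [z /DB[x ->]|x yE] := @mx_solvable _ _ B^T y^T R_coh R_ann.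
  by rewrite -mulmxA -[D]trmxK -trmx_mul yD trmx0 mulmx0.
by exists x^T; rewrite -[LHS]trmxK yE trmx_mul trmxK.
Qed.

Lemma dual_exact_fg_relations : dual_exact R -> fg_relations R^o.
Proof.
move=> /dual_exact_coherent R_coh m e.
have [k [D De]] := R_coh _ _ (\col_i e i : 'cV[R]_m).
exists k, D => y; rewrite -De; split=> [ye|ye].
  apply/matrixP => i j; have := congr1 (@^~ i) ye; rewrite mxact_col !ord1 => ->.
  by rewrite mxE.
by apply/funext => i; rewrite mxact_col ye mxE.
Qed.

End DualExact.

Section SemiregularDualExact.
Variable R : comNzRingType.

(** Embed the cokernel of B in a flat module: the images x of the basis
vectors satisfy B x = 0, hence x = C z with B C = 0. A row killed by C is then
sent to 0 in the cokernel. *)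
Lemma semiregular_dual_exact : semiregular R -> dual_exact R.
Proof.
move=> R_semi m n B.
have [Q [pi [_ pi0]]] : exists (Q : lmodType R) (pi : {linear 'rV[R]_n -> Q}),
    (forall q, exists y, pi y = q) /\
    forall y, pi y = 0 <-> exists x, y = x *m B.
  apply: quotient_by; split=> [|a _ _ [x ->] [x' ->]].
    by exists 0; rewrite mul0mx.
  by exists (a *: x + x'); rewrite mulmxDl scalemxAl.
have [F [f [F_flat f_inj]]] := R_semi Q.
pose x j := f (pi (delta_mx 0 j)).
have xE (y : 'rV_n) : y ** x = cst (f (pi y)).
  apply/funext => i; rewrite ord1 /mxact /cst [in RHS](row_sum_delta y).
  by rewrite !linear_sum; apply: eq_bigr => j _; rewrite !linearZ_LR.
have /(flat_eqn_flat F_flat)[k [C [z [BC xz]]]] : B ** x = 0.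
  apply: mxact_rowP => i; rewrite xE (_ : pi _ = 0) ?linear0 //.
  by apply/pi0; exists (delta_mx 0 i); rewrite rowE.
exists k, C => y; split=> [yC|[u ->]]; last by rewrite -mulmxA BC mulmx0.
apply/pi0/f_inj; rewrite linear0; have := congr1 (@^~ 0) (xE y).
by rewrite xz -mxactA yC mxact0l.
Qed.

(** The finitely many elements that occur are the images of the basis of a
free module, modulo the relations in L; m is not 0 in M, so its basis vector
is outside the row space of the relations, and some coordinate of an embedding
into a free module separates it from 0. A triple (a, u, v) stands for the
relation saying that f is linear on a u + v. *)
Lemma separating_functional (M : lmodType R) (L : seq (R * M * M)) (m : M) :
  dual_exact R -> m != 0 -> exists f : M -> R,
    (forall t, t \in L ->
       f (t.1.1 *: t.1.2 + t.2) = t.1.1 * f t.1.2 + f t.2) /\ f m != 0.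
Proof.
move=> R_dual m0.
pose X := m :: flatten [seq [:: t.1.1 *: t.1.2 + t.2; t.1.2; t.2] | t <- L].
pose x (j : 'I_(size X)) := nth 0 X j.
pose d v : 'rV[R]_(size X) := \row_j (j == index v X :> nat)%:R.
have dx v : v \in X -> d v ** x = cst v.
  move=> vX; have vi := vX; rewrite -index_mem in vi.
  apply/funext => i; rewrite /mxact (bigD1 (Ordinal vi)) //= mxE eqxx scale1r.
  rewrite /x nth_index // big1 ?addr0 // => j.
  by rewrite mxE -val_eqE /= => /negPf ->; rewrite scale0r.
have LX t : t \in L ->
    [/\ t.1.1 *: t.1.2 + t.2 \in X, t.1.2 \in X & t.2 \in X].
  move=> tL; split; rewrite in_cons; apply/orP; right; apply/flatten_mapP;
    by exists t; rewrite // !in_cons eqxx ?orbT.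
pose rel t := d (t.1.1 *: t.1.2 + t.2) - (t.1.1 *: d t.1.2 + d t.2).
have [k [C BC]] := R_dual _ _ (\matrix_(i < size L) rel (tnth (in_tuple L) i)).
set B := \matrix_i _ in BC.
have Bx : B ** x = 0.
  apply: mxact_rowP => i; rewrite rowK.
  have /LX[] : tnth (in_tuple L) i \in L by rewrite mem_tnth.
  case: (tnth _ _) => [[a u] v] /= auv uX vX.
  rewrite /rel /= mxactBl mxactDl mxactZl !dx //; apply/funext => ?.
  exact: subrr.
have /existsP[l mCl] : [exists l, (d m *m C) 0 l != 0].
  apply: contraNT m0 => /existsPn mC; have /BC[z mz] : d m *m C = 0.
    by apply/rowP => l; rewrite [RHS]mxE; apply/eqP; have := mC l; rewrite negbK.
  have := dx m; rewrite mz mxactA Bx mxact0r inE eqxx => /(_ erefl).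
  by move=> /(congr1 (@^~ 0)); rewrite /cst => <-.
exists (fun v => (d v *m C) 0 l); split=> // t tL.
have /tnthP[i ti] : t \in in_tuple L by [].
have := congr1 (row i) (mx_exact_mul0 BC).
rewrite row_mul rowK -ti row0 mulmxBl => /eqP; rewrite subr_eq0 => /eqP ->.
by rewrite mulmxDl -scalemxAl 2!mxE.
Qed.

(** The flat module is a product, over m in M, of powers of R reduced along
the filter of finite lists L of linear relations. The functions of
[separating_functional] are linear up to this filter, so they define an
embedding of M. The reduced power is flat because R is coherent: a system B x
= 0 which holds eventually is solved coordinate by coordinate with one matrix
D generating the kernel of B. *)
Lemma dual_exact_semiregular : dual_exact R -> semiregular R.
Proof.
move=> R_dual M; pose J := (M * seq (R * M * M))%type.
pose K (h : J -> R^o) :=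
  forall m, exists L0 : seq (R * M * M), forall L, {subset L0 <= L} ->
    h (m, L) = 0.
have [F [pi [pi_surj pi0]]] :
    exists (F : lmodType R) (pi : {linear (J -> R^o) -> F}),
    (forall q, exists h, pi h = q) /\ forall h, pi h = 0 <-> K h.
  apply: quotient_by; split=> [m|a h h' Kh Kh' m]; first by exists [::].
  have [[L0 hL0] [L1 hL1]] := (Kh m, Kh' m); exists (L0 ++ L1) => L LL.
  rewrite -[LHS]/(a *: h (m, L) + h' (m, L)).
  rewrite hL0 ?hL1 ?scaler0 ?addr0 // => t tL; apply: LL;
    by rewrite mem_cat tL ?orbT.
have pi_eq h h' : (forall m, exists L0 : seq (R * M * M),
    forall L, {subset L0 <= L} -> h (m, L) = h' (m, L)) -> pi h = pi h'.
  move=> hh'; apply/eqP; rewrite -subr_eq0 -linearB; apply/eqP/pi0 => m.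
  have [L0 hL0] := hh' m; exists L0 => L /hL0 hL.
  by rewrite -[LHS]/(h (m, L) - h' (m, L)) hL subrr.
have /choice[phi phiP] (j : J) : exists f : M -> R,
    (forall t, t \in j.2 ->
       f (t.1.1 *: t.1.2 + t.2) = t.1.1 * f t.1.2 + f t.2) /\
    (j.1 != 0 -> f j.1 != 0).
  have [->|j0] := eqVneq j.1 0.
    by exists (fun=> 0); split=> // t _; rewrite mulr0 addr0.
  by have [f [f_lin fj]] := separating_functional j.2 R_dual j0; exists f.
have [i iE] : exists i : {linear M -> F},
    forall v, i v = pi (fun j => phi j v : R^o).
  apply: linear_of_prop => a u v; rewrite -linearP; apply: pi_eq => m.
  exists [:: (a, u, v)] => L LL; have [] := phiP (m, L).
  by move=> /(_ (a, u, v)) /= -> //; apply: LL; rewrite inE.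
exists F, i; split; last first.
  move=> u v uv; apply/eqP; rewrite -subr_eq0; apply/eqP.
  have : i (u - v) = 0 by rewrite linearB uv subrr.
  rewrite iE => /pi0/(_ (u - v))[L0 /(_ L0)].
  have [_] := phiP (u - v, L0); case: (eqVneq (u - v) 0) => //= _ /(_ isT).
  by move=> phi0 /(_ (fun _ => id)) phiE; move: phi0; rewrite phiE eqxx.
apply: eqn_flat_flat => m n B x Bx.
have [k [D DB]] := dual_exact_coherent R_dual B^T.
have BD : B *m D^T = 0.
  by apply: trmx_inj; rewrite trmx_mul trmxK (mx_exact_mul0 DB) trmx0.
have /choice[x' x'E] j : exists h, pi h = x j by exact: pi_surj.
pose v j : 'cV_n := \col_l x' l j.
have /choice[z zE] j : exists z : 'cV_k, B *m v j = 0 -> v j = D^T *m z.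
  have [Bv|Bv] := pselect (B *m v j = 0); last by exists 0.
  have /DB[y yE] : (v j)^T *m B^T = 0 by rewrite -trmx_mul Bv trmx0.
  by exists y^T => _; rewrite -trmx_mul -yE trmxK.
exists k, D^T, (fun l => pi (fun j => z j l 0)); split=> //.
apply/funext => l; rewrite -x'E.
transitivity (pi ((D^T ** (fun l j => z j l 0 : R^o)) l)); last first.
  exact: linear_mxact.
apply: pi_eq => u.
have /choice[L0 L0P] (i0 : 'I_m) : exists L0 : seq (R * M * M),
    forall L, {subset L0 <= L} -> (B ** x') i0 (u, L) = 0.
  have /pi0/(_ u) // : pi ((B ** x') i0) = 0.
  rewrite linear_mxact (_ : pi \o x' = x) ?Bx //.
  by apply/funext => j; apply: x'E.
exists (flatten (codom L0)) => L LL.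
have /zE vE : B *m v (u, L) = 0.
  apply/matrixP => a b; rewrite ord1 !mxE -[RHS](L0P a L); last first.
    by move=> t tL; apply: LL; apply/flattenP; exists (L0 a); rewrite ?codom_f.
  by rewrite /mxact fct_sumE; apply: eq_bigr => j _; rewrite mxE.
have /matrixP/(_ l 0) := vE; rewrite !mxE => ->.
by rewrite /mxact fct_sumE; apply: eq_bigr => j _.
Qed.

End SemiregularDualExact.

(** * Coherent modules and finitely generated relations *)

Section Coherence.
Variables (R : comNzRingType) (V : lmodType R).

Lemma finitely_generatedP (S : submodClosed V) :
  finitely_generated (submod S) <-> exists n (s : 'I_n -> V),
    forall v, v \in S <-> exists y : 'rV_n, v = (y ** s) 0.
Proof.
have [f fE] : exists f : {linear submod S -> V}, forall v, f v = submod_val v.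
  by apply: linear_of_prop.
split=> [[n [s sP]]|[n [s sP]]].
  exists n, (fun i => submod_val (s i)) => v; split=> [vS|[y ->]].
    have [c vE] := sP (SubMod vS); exists (\row_i c i).
    rewrite -[v]/(submod_val (SubMod vS)) -fE vE linear_sum.
    by apply: eq_bigr => i _; rewrite linearZ_LR mxE fE.
  by apply: rpred_sum => i _; apply: rpredZ; case: (s i).
have sS i : s i \in S.
  by apply/sP; exists (delta_mx 0 i); rewrite mxact_delta_row.
exists n, (fun i => SubMod (sS i)) => -[v vS].
have /sP[y vE] := vS; exists (fun i => y 0 i); apply: val_inj.
rewrite -[RHS]/(submod_val _) -fE linear_sum [LHS]vE; apply: eq_bigr => i _.
by rewrite linearZ_LR fE.
Qed.

Lemma span_submod m (e : 'I_m -> V) :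
  exists S : submodClosed V, forall v,
    v \in S <-> exists y : 'rV_m, v = (y ** e) 0.
Proof.
apply: submod_of_prop; split=> [|a _ _ [y ->] [z ->]].
  by exists 0; rewrite mxact0l.
by exists (a *: y + z); rewrite mxactDl mxactZl.
Qed.

Lemma mxact_row_eq0 m (y : 'rV[R]_m) (e : 'I_m -> V) :
  (y ** e) 0 = 0 -> y ** e = 0.
Proof. by move=> ye; apply/funext => i; rewrite ord1. Qed.

(** The presentation of the span S of e that coherence provides need not be
the one on e. With U and W expressing each set of generators by the other, the
relations on e are generated by those of the given presentation transported by
W, together with the rows of 1 - U W. *)
Lemma coherent_fg_relations : coherent_module V -> fg_relations V.
Proof.
move=> V_coh m e; have [S SP] := span_submod e.
have /V_coh[p [q [g [f [exact_gf f_surj]]]]] : finitely_generated (submod S).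
  by apply/finitely_generatedP; exists m, e.
have [h hE] : exists h : {linear submod S -> V}, forall v, h v = submod_val v.
  by apply: linear_of_prop.
have h_inj v : h v = 0 -> v = 0.
  by move=> hv; apply: val_inj; move: hv; rewrite hE.
have f_onto v : v \in S -> exists y, h (f y) = v.
  move=> vS; have : range f (SubMod vS) by rewrite f_surj.
  by move=> [y _ fy]; exists y; rewrite fy hE.
have /choice[u uE] i : exists y, h (f y) = e i.
  by apply/f_onto/SP; exists (delta_mx 0 i); rewrite mxact_delta_row.
have /choice[w wE] j : exists y : 'rV_m, h (f (delta_mx 0 j)) = (y ** e) 0.
  by apply/SP; rewrite hE; case: (f _).
pose U := \matrix_i u i; pose W := \matrix_j w j.
have hfE y : h (f y) = ((y *m W) ** e) 0.
  rewrite mxactA [in LHS](row_sum_delta y) !linear_sum; apply: eq_bigr => j _.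
  by rewrite !linearZ_LR wE -[w j](rowK w) mxact_row.
have UWe : (U *m W) ** e = e.
  apply/funext => i; have := hfE (row i U).
  by rewrite -row_mul mxact_row rowK uE => ->.
exists (p + m)%N, (col_mx (lin1_mx g *m W) (1%:M - U *m W)) => y.
split=> [ye|[x ->]].
  have /h_inj fyU : h (f (y *m U)) = 0.
    by rewrite hfE -mulmxA mxactA UWe ye.
  have [t _ gt] : range g (y *m U) by rewrite exact_gf.
  exists (row_mx t y); rewrite mul_row_col mulmxA mul_rV_lin1 gt.
  by rewrite mulmxBr mulmx1 mulmxA addrC subrK.
have gWe : (lin1_mx g *m W) ** e = 0.
  apply: mxact_rowP => i; rewrite row_mul; apply: mxact_row_eq0; rewrite -hfE.
  have : range g (row i (lin1_mx g)).
    by exists (delta_mx 0 i) => //; rewrite rowE mul_rV_lin1.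
  by rewrite exact_gf => ->; rewrite linear0.
by rewrite mxactA mxact_col_mx gWe mxactBl mxact1 UWe subrr tcat0 mxact0r.
Qed.

Lemma fg_relations_coherent : fg_relations V -> coherent_module V.
Proof.
move=> V_rel S [n [s sP]].
have [h hE] : exists h : {linear submod S -> V}, forall v, h v = submod_val v.
  by apply: linear_of_prop.
have h_inj v : h v = 0 -> v = 0.
  by move=> hv; apply: val_inj; move: hv; rewrite hE.
have [k [D DP]] := V_rel _ (h \o s).
have [f fE] : exists f : {linear 'rV[R]_n -> submod S},
    forall y, f y = (y ** s) 0.
  by apply: linear_of_prop => a u v; rewrite mxactDl mxactZl.
exists k, n, (mulmxr D), f; split; apply/seteqP; split=> //.
- move=> _ [x _ <-]; apply: h_inj; rewrite fE linear_mxact.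
  by have /DP -> : exists z, x *m D = z *m D by exists x.
- move=> y fy; have /DP[x ->] : y ** (h \o s) = 0.
    by apply: mxact_row_eq0; rewrite -linear_mxact -fE fy linear0.
  by exists x.
- move=> v _; have [c ->] := sP v; exists (\row_i c i) => //.
  by rewrite fE; apply: eq_bigr => i _; rewrite mxE.
Qed.

End Coherence.

(** * The trivial extension *)

Lemma fg_relations_mxP (R : comNzRingType) (V : lmodType R) m k (e : 'I_m -> V)
    (D : 'M[R]_(k, m)) :
  (forall y : 'rV_m, y ** e = 0 <-> exists x, y = x *m D) ->
  forall p (Y : 'M_(p, m)), Y ** e = 0 <-> exists X, Y = X *m D.
Proof.
move=> De p Y; split=> [Ye|[X ->]]; last first.
  rewrite mxactA (_ : D ** e = 0) ?mxact0r //.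
  by apply: mxact_rowP => i; apply/De; exists (delta_mx 0 i); rewrite rowE.
have /choice[x xE] i : exists x, row i Y = x *m D.
  by apply/De; rewrite mxact_row Ye.
by exists (\matrix_i x i); apply/row_matrixP => i; rewrite row_mul rowK.
Qed.

Section TrivialExtensionMatrices.
Variables (A : comNzRingType) (E : lmodType A).
Local Notation R := (trivext E).

Lemma trivext_fst_sum I (r : seq I) (P : pred I) (F : I -> R) :
  (\sum_(i <- r | P i) F i).1 = \sum_(i <- r | P i) (F i).1.
Proof. by apply: (big_morph (fun x : R => x.1)). Qed.

Lemma trivext_snd_sum I (r : seq I) (P : pred I) (F : I -> R) :
  (\sum_(i <- r | P i) F i).2 = \sum_(i <- r | P i) (F i).2.
Proof. by apply: (big_morph (fun x : R => x.2)). Qed.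

Lemma trivext_eq (x y : R) : x.1 = y.1 -> x.2 = y.2 -> x = y.
Proof. by case: x y => [a e] [b f] /= -> ->. Qed.

Lemma trivext_mul_fst (x y : R) : (x * y).1 = x.1 * y.1.
Proof. by []. Qed.

Lemma trivext_mul_snd (x y : R) : (x * y).2 = x.1 *: y.2 + y.1 *: x.2.
Proof. by []. Qed.

Definition tmx m n (K : 'M[A]_(m, n)) (f : 'I_m -> 'I_n -> E) : 'M[R]_(m, n) :=
  \matrix_(i, j) (K i j, f i j).

Lemma tmx_eta m n (D : 'M[R]_(m, n)) :
  D = tmx (\matrix_(i, j) (D i j).1) (fun i j => (D i j).2).
Proof. by apply/matrixP => i j; rewrite !mxE; case: (D i j). Qed.

Lemma tmxD m n (K L : 'M_(m, n)) f g : tmx K f + tmx L g = tmx (K + L) (f + g).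
Proof. by apply/matrixP => i j; rewrite !mxE. Qed.

Lemma tmx_mul m n p (U : 'M[A]_(m, n)) (g : 'I_m -> 'I_n -> E) (K : 'M_(n, p))
    (f : 'I_n -> 'I_p -> E) :
  tmx U g *m tmx K f = tmx (U *m K) (fun i => (U ** f) i + K^T ** g i).
Proof.
apply/matrixP => i j; rewrite !mxE; apply: trivext_eq => /=.
  by rewrite trivext_fst_sum; apply: eq_bigr => l _; rewrite !mxE.
rewrite trivext_snd_sum -[RHS]/((U ** f) i j + (K^T ** g i) j).
rewrite {1}/mxact fct_sumE /mxact -big_split; apply: eq_bigr => l _.
by rewrite !mxE trivext_mul_snd.
Qed.

Lemma tmx_act m n (K : 'M[A]_(m, n)) (f : 'I_m -> 'I_n -> E)
    (c : 'I_n -> R^o) i :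
  (tmx K f ** c) i =
  ((K ** (fun j => (c j).1 : A^o)) i,
   (K ** (fun j => (c j).2)) i + (\row_j (c j).1 ** f i) 0).
Proof.
apply: trivext_eq => /=.
  by rewrite trivext_fst_sum; apply: eq_bigr => j _; rewrite mxE.
rewrite trivext_snd_sum /mxact -big_split /=; apply: eq_bigr => j _.
by rewrite !mxE.
Qed.

End TrivialExtensionMatrices.

Section TrivialExtensionIsDualExact.
Variables (A : idomainType) (E : lmodType A).
Local Notation R := (trivext E).

(** Generators rather than submodules, so that annihilators in the trivial
extension can be computed on tuples. *)
Definition tuple_DAC1 : Prop := forall n (a : 'I_n -> A) (b : A),
  (forall v : E, (forall i, a i *: v = 0) -> b *: v = 0) ->
  exists y : 'I_n -> A, b = \sum_i y i * a i.

Definition tuple_DAC2 : Prop := forall n (e : 'I_n -> E) (v : E),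
  (forall a : A, (forall i, a *: e i = 0) -> a *: v = 0) ->
  exists y : 'rV_n, v = (y ** e) 0.

Hypotheses (A_coh : fg_relations A^o) (E_coh : fg_relations E).
Hypotheses (E_div : divisible E).
Hypotheses (E_tor : torsion E \/ exists h : E, forall e, exists a, e = a *: h).
Hypotheses (E_ann : forall x : A, x != 0 -> exists n (s : 'I_n -> E),
  forall v, x *: v = 0 <-> exists y : 'rV_n, v = (y ** s) 0).
Hypotheses (E_DAC1 : tuple_DAC1) (E_DAC2 : tuple_DAC2).

(** Relations (b, g) on c are treated in two stages: the rows of K account for
the A-components b, after which only relations of the form (0, g) remain. *)
Lemma trivext_relations_of_gens m (c : 'I_m -> R^o) k k'
    (K : 'M[A]_(k, m)) f (D' : 'M[R]_(k', m)) :
  tmx K f ** c = 0 -> D' ** c = 0 ->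
  (forall (b : 'rV_m) (g : 'I_1 -> 'I_m -> E),
     tmx b g ** c = 0 -> exists x, b = x *m K) ->
  (forall (g : 'I_1 -> 'I_m -> E), tmx 0 g ** c = 0 ->
     exists x, tmx 0 g = x *m col_mx (tmx K f) D') ->
  exists n (D : 'M[R]_(n, m)), forall y : 'rV_m,
    y ** c = 0 <-> exists x, y = x *m D.
Proof.
move=> Kc D'c c1 c2; exists (k + k')%N, (col_mx (tmx K f) D') => y.
split=> [|[x ->]]; last first.
  by rewrite mxactA mxact_col_mx Kc D'c tcat0 mxact0r.
rewrite [y]tmx_eta; set b := (\matrix_(i, j) _); set g := (fun i j => _) => yc.
have [x bE] := c1 _ _ yc.
have [|z zE] := c2 (g - (fun i => (x ** f) i + K^T ** (0 : _ -> _ -> E) i)).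
  rewrite -[0](subrr b) [X in b - X]bE -[RHS](subrr (tmx b g ** c)) [in RHS]yc.
  rewrite (_ : tmx _ _ = tmx b g - tmx x 0 *m tmx K f) ?mxactBl ?mxactA.
    by rewrite Kc mxact0r yc.
  by rewrite tmx_mul; apply/matrixP => i j; rewrite !mxE.
exists (row_mx (tmx x 0) 0 + z).
rewrite mulmxDl mul_row_col mul0mx addr0 -zE tmx_mul tmxD addr0 -bE.
by rewrite addrC subrK.
Qed.

(** When some c_i0 has a nonzero A-component, divisibility lifts each relation
in A to a relation on c by a correction at the index i0, and a relation (0, g)
is reduced by the trivial relations S between a_i0 and the a_j to one
supported at i0, with value killed by a_i0. When all A-components vanish, the
relations are all (b, g) with b a relation on e; a scalar s killing e turns
every g = s u into a multiple of relations in A, and if E is generated by one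
element h there are finitely many generators (0, h) to add. *)
Lemma trivext_fg_relations : fg_relations R^o.
Proof.
move=> m c; pose a j : A^o := (c j).1; pose e j := (c j).2.
have [[i0 ai0]|a0] := pselect (exists i, a i != 0).
  have [k [K Ka]] := A_coh a.
  have /(fg_relations_mxP Ka) Ka0 : exists X, K = X *m K.
    by exists 1%:M; rewrite mul1mx.
  have /choice[t tE] l : exists t, a i0 *: t = - (K ** e) l by exact: E_div.
  have [n [s sP]] := E_ann ai0.
  have s_ann j : a i0 *: s j = 0.
    by apply/sP; exists (delta_mx 0 j); rewrite mxact_delta_row.
  pose at_i0 (v : E) : 'I_m -> E := fun j => (j == i0)%:R *: v.
  have at_i0E v : (\row_j a j ** at_i0 v) 0 = a i0 *: v.
    rewrite /mxact (bigD1 i0) //= /at_i0 mxE eqxx scale1r.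
    by rewrite big1 ?addr0 // => j /negPf ->; rewrite scale0r scaler0.
  apply: (@trivext_relations_of_gens m c k n K (fun l => at_i0 (t l))
    (tmx 0 (fun j => at_i0 (s j)))).
  - apply/funext => l; rewrite tmx_act at_i0E -/a Ka0 tE.
    by rewrite subrr.
  - apply/funext => l; rewrite tmx_act at_i0E -/a !mxact0l s_ann.
    by rewrite addr0.
  - move=> b g; move=> bc; apply/Ka; apply: mxact_row_eq0.
    by have := congr1 (@^~ 0) bc; rewrite tmx_act => -[].
  move=> g gc; have /choice[u uE] j : exists u, a i0 *: u = g 0 j.
    exact: E_div.
  have [X SX] : exists X, (a i0)%:M - (\col_j a j) *m delta_mx 0 i0 = X *m K.
    apply/(fg_relations_mxP Ka).
    rewrite mxactBl mxactA mxact_delta_row; apply/funext => j.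
    rewrite -[LHS]/(_ - _) /mxact big_ord1 (bigD1 j) //= big1 => [|l /negPf lj].
      rewrite !mxE eqxx mulr1n addr0 -[a j *: _]/(a j * a i0) mulrC.
      exact: subrr.
    by rewrite mxE eq_sym lj scale0r.
  pose v := (\row_j a j ** u) 0.
  have [z vE] : exists z : 'rV_n, v = (z ** s) 0.
    apply/sP; rewrite /v; have := congr1 (@^~ 0) gc.
    rewrite tmx_act !mxact0l => /(congr1 snd) /= gc0.
    rewrite -[RHS]gc0 -[RHS]/(0 + _) add0r.
    rewrite -[LHS]/((a i0 *: (_ ** u)) 0) -mxactZr; congr ((_ ** _) _).
    by apply/funext => j; rewrite -uE.
  exists (row_mx (tmx 0 (cst u) *m tmx X 0) (tmx z 0)).
  rewrite mul_row_col -mulmxA !tmx_mul -SX !mul0mx mulmx0 tmxD addr0; congr tmx.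
  apply/funext => i; rewrite ord1; apply/funext => j.
  have Su : (((a i0)%:M - (\col_j a j) *m delta_mx 0 i0)^T ** u) j =
      g 0 j - (j == i0)%:R *: v.
    rewrite linearB /= tr_scalar_mx trmx_mul mxactBl -scalemx1 mxactZl mxact1.
    rewrite mxactA; congr (_ - _); first exact: uE.
    rewrite /mxact big_ord1 !mxE eqxx /=; congr (_ *: _).
    by apply: eq_bigr => l _; rewrite !mxE.
  have zs : (z ** (fun l => at_i0 (s l))) 0 j = (j == i0)%:R *: v.
    rewrite vE /mxact fct_sumE scaler_sumr; apply: eq_bigr => l _.
    by rewrite scalerA mulrC -scalerA.
  rewrite trmx0 -[RHS]/((((0 : 'rV_m) ** _) 0 j + (_ ** u) j) +
                        ((z ** _) 0 j + ((0 : 'M_(m, n)) ** _) j)).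
  rewrite !mxact0l -[RHS]/(0 + (_ ** u) j + ((z ** _) 0 j + 0)).
  by rewrite Su zs add0r addr0 subrK.
have {}a0 i : a i = 0 by apply: contra_notP a0 => /eqP ai; exists i.
have [k [K Ke]] := E_coh e.
have Ke0 : K ** e = 0.
  by apply/(fg_relations_mxP Ke); exists 1%:M; rewrite mul1mx.
have act0 n (U : 'M_(n, m)) g : U ** e = 0 -> tmx U g ** c = 0.
  move=> Ue; apply/funext => l; rewrite tmx_act -/e Ue; apply: trivext_eq => /=.
    by rewrite /mxact big1 // => j _; rewrite -/(a j) a0 scaler0.
  rewrite /mxact big1 ?addr0 // => j _.
  by rewrite mxE -/(a j) a0 scale0r.
have actP (b : 'rV_m) g : tmx b g ** c = 0 -> exists x, b = x *m K.
  move=> bc; apply/Ke; apply: mxact_row_eq0; have := congr1 (@^~ 0) bc.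
  rewrite tmx_act => /(congr1 snd) /=; rewrite [X in _ + X](_ : _ = 0) ?addr0 //.
  by rewrite /mxact big1 // => j _; rewrite mxE -/(a j) a0 scale0r.
case: E_tor => [tor|[h hP]].
  have [s s0 se] : exists2 s : A, s != 0 & forall i, s *: e i = 0.
    have /choice[s sP] i : exists s, s != 0 /\ s *: e i = 0.
      by have [s s0 se] := tor (e i); exists s.
    exists (\prod_i s i); first by apply/prodf_neq0 => i _; have [] := sP i.
    move=> i; rewrite (bigD1 i) //= mulrC -scalerA.
    by have [_ ->] := sP i; rewrite scaler0.
  apply: (@trivext_relations_of_gens m c k 0 K 0 0) => //; first exact: act0.
    by rewrite mxact0l.
  move=> g _; have /choice[u uE] j : exists u, s *: u = g 0 j by exact: E_div.
  have [X sX] : exists X, s%:M = X *m K.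
    apply/(fg_relations_mxP Ke); rewrite -scalemx1 mxactZl mxact1.
    by apply/funext => i; exact: se.
  exists (row_mx (tmx 0 (cst u) *m tmx X 0) 0).
  rewrite mul_row_col mul0mx addr0 -mulmxA !tmx_mul -sX mul0mx; congr tmx.
  apply/funext => i; rewrite ord1; apply/funext => j.
  rewrite mxact0l tr_scalar_mx -scalemx1 mxactZl mxact1.
  by rewrite -[RHS]/(0 + s *: u j) add0r uE.
pose D' : 'M[R]_m := tmx 0 (fun i j => (j == i)%:R *: h).
apply: (@trivext_relations_of_gens m c k m K 0 D') => //; first exact: act0.
  by apply: act0; rewrite mxact0l.
move=> g _; have /choice[r rE] j : exists r, g 0 j = r *: h by exact: hP.
exists (row_mx 0 (tmx (\row_j r j) 0)).
rewrite mul_row_col mul0mx add0r tmx_mul mulmx0; congr tmx.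
apply/funext => i; rewrite ord1; apply/funext => j.
rewrite trmx0 mxact0l addr0 /mxact fct_sumE (bigD1 j) //= big1 => [|l /negPf lj].
  by rewrite addr0 -[RHS]/(_ *: ((j == j)%:R *: h)) mxE eqxx scale1r rE.
by rewrite -[LHS]/(_ *: ((j == l)%:R *: h)) eq_sym lj scale0r scaler0.
Qed.

(** If some a_i0 has a nonzero A-component, the ideal contains E by
divisibility and is killed by every (0, v) with v killed by the ideal of the
A-components; so only the first components matter and DAC1 applies. Otherwise
the ideal lies in E: the annihilating elements (0, v) give b.1 E = 0, hence
b.1 = 0 by DAC1 for the zero ideal, and the elements (s, 0) reduce b.2 to
DAC2. *)
Lemma trivext_ann_closed : ann_closed R.
Proof.
move=> m a b ab.
have [[i0 ai0]|a0] := pselect (exists i, (a i).1 != 0).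
  have [v va|y yE] := @E_DAC1 m (fun i => (a i).1) b.1.
    suff /(congr1 snd) : ((0, v) : R) * b = 0.
      by rewrite trivext_mul_snd scale0r add0r.
    apply: ab => i; apply: trivext_eq; rewrite ?trivext_mul_fst ?mul0r //.
    by rewrite trivext_mul_snd scale0r add0r va.
  pose d := b.2 - \sum_i y i *: (a i).2.
  have [g gE] := E_div ai0 d.
  exists (fun i => (y i, (i == i0)%:R *: g)); apply: trivext_eq.
    by rewrite trivext_fst_sum yE.
  rewrite trivext_snd_sum; under eq_bigr do rewrite trivext_mul_snd /=.
  rewrite big_split /= [X in _ + X](bigD1 i0) //= eqxx scale1r gE.
  rewrite [X in _ + (_ + X)]big1 => [|i /negPf ->].
    by rewrite addr0 addrC subrK.
  by rewrite scale0r scaler0.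
have {}a0 i : (a i).1 = 0 by apply: contra_notP a0 => /eqP ai; exists i.
have b0 : b.1 = 0.
  have [v _|y ->] := @E_DAC1 0 (fun _ => 0) b.1; last by rewrite big_ord0.
  suff /(congr1 snd) : ((0, v) : R) * b = 0.
    by rewrite trivext_mul_snd scale0r add0r.
  apply: ab => i; apply: trivext_eq; rewrite ?trivext_mul_fst ?mul0r //.
  by rewrite trivext_mul_snd a0 !scale0r addr0.
have [s sa|y yE] := @E_DAC2 m (fun i => (a i).2) b.2.
  suff /(congr1 snd) : ((s, 0) : R) * b = 0.
    by rewrite trivext_mul_snd scaler0 addr0.
  apply: ab => i; apply: trivext_eq; rewrite ?trivext_mul_fst ?a0 ?mulr0 //.
  by rewrite trivext_mul_snd sa scaler0 addr0.
exists (fun i => (y 0 i, 0)); apply: trivext_eq.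
  by rewrite trivext_fst_sum b0 big1 // => i _; rewrite trivext_mul_fst a0 mulr0.
rewrite trivext_snd_sum yE; apply: eq_bigr => i _.
by rewrite trivext_mul_snd /= scaler0 addr0.
Qed.

Lemma trivext_dual_exact : dual_exact R.
Proof. exact: dual_exact_of_ideals trivext_fg_relations trivext_ann_closed. Qed.

End TrivialExtensionIsDualExact.

(** * Double annihilators on tuples, and lines over a field *)

Section Translations.
Variables (A : idomainType) (E : lmodType A).

Lemma DAC1_tuple : DAC1 E <-> tuple_DAC1 E.
Proof.
split=> [dac n a b ab|dac S].
  have [S SP] := span_submod (a : 'I_n -> A^o).
  have Sfg : finitely_generated (submod S).
    by apply/finitely_generatedP; exists n, a.
  have : [set` S]%classic b.
    rewrite -(dac S Sfg) => v Sv; apply: ab => i; apply: Sv; apply/SP.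
    by exists (delta_mx 0 i); rewrite mxact_delta_row.
  by move=> /SP[y ->]; exists (fun i => y 0 i).
move=> /finitely_generatedP[n [s sP]]; apply/seteqP.
split=> [b bS|b bS v]; last exact.
have [v va|y ->] := dac n s b.
  apply: bS => _ /sP[y ->]; rewrite /mxact scaler_suml big1 // => i _.
  by rewrite -scalerA va scaler0.
by apply/sP; exists (\row_i y i); apply: eq_bigr => i _; rewrite mxE.
Qed.

Lemma DAC2_tuple : DAC2 E <-> tuple_DAC2 E.
Proof.
split=> [dac n e v ev|dac S].
  have [S SP] := span_submod e.
  have Sfg : finitely_generated (submod S).
    by apply/finitely_generatedP; exists n, e.
  have : [set` S]%classic v.
    rewrite -(dac S Sfg) => a aS; apply: ev => i; apply: aS; apply/SP.
    by exists (delta_mx 0 i); rewrite mxact_delta_row.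
  by move=> /SP.
move=> /finitely_generatedP[n [s sP]]; apply/seteqP.
split=> [v vS|v vS a]; last exact.
have [a sa|y ->] := dac n s v.
  apply: vS => _ /sP[y ->]; rewrite /mxact scaler_sumr big1 // => i _.
  by rewrite scalerA mulrC -scalerA sa scaler0.
by apply/sP; exists y.
Qed.

Lemma ann_elt_fgP (x : A) : finitely_generated (submod (ann_elt E x)) <->
  exists n (s : 'I_n -> E),
    forall v, x *: v = 0 <-> exists y : 'rV_n, v = (y ** s) 0.
Proof.
rewrite finitely_generatedP; split=> -[n [s sP]]; exists n, s => v.
  by rewrite -sP; split=> /eqP.
by rewrite -sP; split=> /eqP.
Qed.

End Translations.

Section Lines.
Variables (A : idomainType) (A_field : GRing.field_axiom A).
Variables (E : lmodType A) (h : E).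
Hypotheses (h_neq0 : h != 0) (h_span : forall v, exists a, v = a *: h).

Let mulVa (a : A) : a != 0 -> a^-1 * a = 1.
Proof. by move=> a0; rewrite mulVr // A_field. Qed.

Let scale_inj (a : A) (v : E) : a != 0 -> a *: v = 0 -> v = 0.
Proof.
by move=> a0 av; rewrite -[v]scale1r -(mulVa a0) -scalerA av scaler0.
Qed.

(** A tuple e with e_i0 nonzero is c e_i0 for a column c of scalars, so the
relations on e are the image of the projection 1 - c delta_i0. *)
Lemma line_fg_relations : fg_relations E.
Proof.
move=> m e; have [[i0 ei0]|e0] := pselect (exists i, e i != 0); last first.
  exists m, 1%:M => y; split=> [_|_]; first by exists y; rewrite mulmx1.
  rewrite (_ : e = 0) ?mxact0r //; apply/funext => i.
  by apply: contra_notP e0 => /eqP ei; exists i.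
have /choice[a aE] i : exists a, e i = a *: h by exact: h_span.
have ai0 : a i0 != 0 by apply: contraNneq ei0 => a0; rewrite aE a0 scale0r.
pose c : 'cV_m := \col_i ((a i0)^-1 * a i).
have cE : c ** (cst (e i0) : 'I_1 -> E) = e.
  apply/funext => i; rewrite /mxact big_ord1 mxE aE [in RHS]aE scalerA mulrAC.
  by rewrite mulVa // mul1r.
exists m, (1%:M - c *m delta_mx 0 i0) => y; split=> [ye|[x ->]].
  exists y; rewrite mulmxBr mulmx1 mulmxA (_ : y *m c = 0) ?mul0mx ?subr0 //.
  apply/matrixP => i j; rewrite !ord1 [RHS]mxE.
  have : ((y *m c) 0 0) *: e i0 = 0.
    have /(congr1 (@^~ 0)) : (y *m c) ** (cst (e i0) : 'I_1 -> E) = 0.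
      by rewrite mxactA cE.
    by rewrite {1}/mxact big_ord1.
  have [// | yc0] := eqVneq ((y *m c) 0 0) 0.
  by move=> /(scale_inj yc0) /eqP; rewrite (negPf ei0).
by rewrite mxactA mxactBl mxact1 mxactA mxact_delta_row cE subrr mxact0r.
Qed.

Lemma line_divisible : divisible E.
Proof.
move=> a a0 e; exists (a^-1 *: e); rewrite scalerA mulrC mulVa //.
by rewrite scale1r.
Qed.

Lemma line_ann (x : A) : x != 0 -> exists n (s : 'I_n -> E),
  forall v, x *: v = 0 <-> exists y : 'rV_n, v = (y ** s) 0.
Proof.
move=> x0; exists 0, 0 => v; split=> [/(scale_inj x0) ->|[y ->]].
  by exists 0; rewrite mxact0l.
by rewrite mxact0r scaler0.
Qed.

Lemma line_DAC1 : tuple_DAC1 E.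
Proof.
move=> n a b ab; have [[i0 ai0]|a0] := pselect (exists i, a i != 0).
  exists (fun i => (i == i0)%:R * (b * (a i0)^-1)); rewrite (bigD1 i0) //= big1.
    by rewrite eqxx mul1r -mulrA mulVa // mulr1 addr0.
  by move=> i /negPf ->; rewrite !mul0r.
exists (fun=> 0); rewrite big1 => [|i _]; last by rewrite mul0r.
have [// | b0] := eqVneq b 0; move/eqP: h_neq0; case.
apply: (scale_inj b0); apply: ab => i.
rewrite (_ : a i = 0) ?scale0r //.
by apply: contra_notP a0 => /eqP ai; exists i.
Qed.

Lemma line_DAC2 : tuple_DAC2 E.
Proof.
move=> n e v ev; have [[i0 ei0]|e0] := pselect (exists i, e i != 0).
  have [a aE] := h_span (e i0); have [b ->] := h_span v.
  have a0 : a != 0 by apply: contraNneq ei0 => a0; rewrite aE a0 scale0r.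
  exists ((b * a^-1) *: delta_mx 0 i0).
  rewrite mxactZl mxact_delta_row -[RHS]/(_ *: e i0) aE scalerA -mulrA.
  by rewrite mulVa ?mulr1.
exists 0; rewrite mxact0l -[v]scale1r; apply: ev => i; rewrite scale1r.
by apply: contra_notP e0 => /eqP ei; exists i.
Qed.

End Lines.

(** * Necessity: what dual exactness says about A and E *)

Section Necessity.
Variables (A : idomainType) (E : lmodType A).
Local Notation R := (trivext E).
Hypothesis R_dual : dual_exact R.

Let R_ann : ann_closed R := dual_exact_ann_closed R_dual.
Let R_rel : fg_relations R^o := dual_exact_fg_relations R_dual.

(** (0, e) is killed by the annihilator of (a, 0), hence is a multiple of (a,
0). *)
Lemma trivext_divisible : divisible E.
Proof.
move=> a a0 e; have [r|c cE] := @R_ann 1%N (fun=> (a, 0)) (0, e).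
- move=> /(_ 0)/(congr1 fst)/eqP; rewrite trivext_mul_fst mulf_eq0 (negPf a0).
  rewrite orbF => /eqP r0; apply: trivext_eq.
    by rewrite trivext_mul_fst mulr0.
  by rewrite trivext_mul_snd r0 !scale0r addr0.
- exists (c 0).2; have /(congr1 snd) := cE; rewrite big_ord1 trivext_mul_snd /=.
  by rewrite scaler0 add0r.
Qed.

(** If e is killed by no nonzero scalar, the annihilator of (0, e) is E, which
kills every (0, v); so (0, v) is a multiple of (0, e) and E = A e.
Divisibility of e by a then inverts a. *)
Lemma trivext_torsion_or_line :
  torsion E \/ GRing.field_axiom A /\ exists f : {linear E -> A^o}, bijective f.
Proof.
have [tor|ntor] := pselect (torsion E); [by left|right].
have [e eP] : exists e : E, forall a, a *: e = 0 -> a = 0.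
  apply: contra_notP ntor => ne e.
  have /existsNP[a /not_implyP[ae a0]] :
    ~ forall a, a *: e = 0 -> a = 0 by apply: contra_not ne => ?; exists e.
  by exists a => //; exact/eqP.
have /choice[c cE] v : exists a, v = a *: e.
  have [r /(_ 0)/(congr1 snd)|c cE] := @R_ann 1%N (fun=> (0, e)) (0, v).
    rewrite trivext_mul_snd scale0r addr0 => /eP r0; apply: trivext_eq.
      by rewrite trivext_mul_fst mulr0.
    by rewrite trivext_mul_snd r0 !scale0r addr0.
  exists (c 0).1; have /(congr1 snd) := cE; rewrite big_ord1 trivext_mul_snd /=.
  by rewrite scale0r addr0.
have e_inj a b : a *: e = b *: e -> a = b.
  move=> ab; apply/eqP; rewrite -subr_eq0; apply/eqP/eP.
  by rewrite scalerBl ab subrr.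
split=> [a a0|].
  have [f fE] := trivext_divisible a0 e; apply/unitrP; exists (c f).
  suff ca : a * c f = 1 by rewrite mulrC ca.
  by apply: e_inj; rewrite -scalerA -cE fE scale1r.
have [f fE] : exists f : {linear E -> A^o}, forall v, f v = c v.
  apply: linear_of_prop => a u v; apply: e_inj.
  by rewrite -cE [X in a *: X + _]cE [X in _ + X]cE scalerA -scalerDl.
exists f; exists (fun a => a *: e) => [v|a]; first by rewrite fE -cE.
by apply: e_inj; rewrite fE -cE.
Qed.

(** Relations on the (a_i, e_i) in the trivial extension, projected to A. It
is used for e = 0 and for a = 0, where the projection is onto the relations on
a and on e respectively. *)
Lemma trivext_row_kernel m (a : 'I_m -> A) (e : 'I_m -> E) :
  exists k (D : 'M[A]_(k, m)),
    (forall y : 'rV_m, y ** (a : 'I_m -> A^o) = 0 -> y ** e = 0 ->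
       exists x, y = x *m D) /\
    D ** (a : 'I_m -> A^o) = 0 /\
    ((forall i, a i = 0) -> D ** e = 0).
Proof.
have [k [D DP]] := R_rel (fun i => (a i, e i)).
have DP0 : D ** (fun i => (a i, e i) : R^o) = 0.
  by apply/(fg_relations_mxP DP); exists 1%:M; rewrite mul1mx.
have [K [f DE]] : exists K f, D = tmx K f.
  by exists (\matrix_(i, j) (D i j).1), (fun i j => (D i j).2); exact: tmx_eta.
exists k, K; split=> [y ya ye|].
  have /DP[x] : tmx y 0 ** (fun i => (a i, e i) : R^o) = 0.
    apply/funext => i; rewrite tmx_act ya ye mxact0r.
    by apply: trivext_eq; rewrite //= addr0.
  rewrite [x]tmx_eta DE tmx_mul; set u := (\matrix_(i, j) _) => yE.
  exists u; apply/matrixP => i j; have /matrixP/(_ i j) := yE.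
  by rewrite !mxE => /(congr1 fst).
have KP i : (K ** (a : 'I_m -> A^o)) i = 0 /\
    (K ** e) i + (\row_j a j ** f i) 0 = 0.
  have := congr1 (@^~ i) DP0; rewrite DE tmx_act => KE.
  by split; [exact: (congr1 fst KE)|exact: (congr1 snd KE)].
split; first by apply/funext => i; have [] := KP i.
move=> a0; apply/funext => i; have [_] := KP i.
rewrite (_ : \row_j a j = 0) ?mxact0l ?addr0 //.
by apply/rowP => j; rewrite !mxE a0.
Qed.

Lemma trivext_base_coherent : fg_relations (A^o : lmodType A).
Proof.
move=> m a; have [k [D [D1 [D2 _]]]] := trivext_row_kernel a 0.
exists k, D => y; split=> [ya|[x ->]]; first by apply: D1; rewrite ?mxact0r.
by rewrite mxactA D2 mxact0r.
Qed.

Lemma trivext_module_coherent : fg_relations E.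
Proof.
move=> m e; have [k [D [D1 [_ D2]]]] := trivext_row_kernel (fun=> 0) e.
exists k, D => y; split=> [ye|[x ->]].
  apply: D1 => //; apply/funext => i; rewrite /mxact big1 // => j _.
  exact: scaler0.
by rewrite mxactA D2 // mxact0r.
Qed.

(** The annihilator of (x, 0) consists of the (0, v) with x v = 0, and its
generators over the trivial extension are generators over A because E acts on
it by 0. *)
Lemma trivext_ann_fg (x : A) : x != 0 -> exists n (s : 'I_n -> E),
  forall v, x *: v = 0 <-> exists y : 'rV_n, v = (y ** s) 0.
Proof.
move=> x0; have [k [D DP]] := @R_rel 1%N (fun=> (x, 0)).
have DP0 : D ** (fun=> (x, 0) : R^o) = 0.
  by apply/(fg_relations_mxP DP); exists 1%:M; rewrite mul1mx.
have DxE i : D i 0 * (x, 0) = 0.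
  by have := congr1 (@^~ i) DP0; rewrite /mxact big_ord1.
have D1 i : (D i 0).1 = 0.
  have /(congr1 fst)/eqP := DxE i; rewrite trivext_mul_fst mulf_eq0 (negPf x0).
  by rewrite orbF => /eqP.
have D2 i : x *: (D i 0).2 = 0.
  by have /(congr1 snd) := DxE i; rewrite trivext_mul_snd scaler0 add0r.
exists k, (fun i => (D i 0).2) => v; split=> [xv|[y ->]]; last first.
  rewrite /mxact scaler_sumr big1 // => i _.
  by rewrite scalerA mulrC -scalerA D2 scaler0.
have /DP[z vE] : (const_mx ((0, v) : R) : 'rV[R]_1) ** (fun=> (x, 0) : R^o) = 0.
  apply/funext => i; rewrite /mxact big_ord1 mxE; apply: trivext_eq => /=.
    by rewrite mul0r.
  by rewrite scaler0 add0r xv.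
exists (\row_i (z 0 i).1); have /matrixP/(_ 0 0)/(congr1 snd) := vE.
rewrite !mxE trivext_snd_sum => v2; rewrite [LHS]v2; apply: eq_bigr => i _.
by rewrite trivext_mul_snd D1 scale0r addr0 mxE.
Qed.

(** If a_i0 is nonzero, the annihilator of the (a_i, 0) is contained in E, so
it kills (b, 0) as soon as b kills the v killed by all a_i. For the zero ideal
the condition says that E is faithful, which holds because E is divisible and
nonzero. *)
Lemma trivext_DAC1 : (exists e : E, e != 0) -> tuple_DAC1 E.
Proof.
move=> [e0 e0_neq0] n a b ab; have [[i0 ai0]|a0] := pselect (exists i, a i != 0).
  have [r ra|c cE] := @R_ann n (fun i => (a i, 0)) (b, 0).
    have r1 : r.1 = 0.
      have /(congr1 fst)/eqP := ra i0; rewrite trivext_mul_fst mulf_eq0.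
      by rewrite (negPf ai0) orbF => /eqP.
    apply: trivext_eq; first by rewrite trivext_mul_fst r1 mul0r.
    rewrite trivext_mul_snd r1 scale0r add0r /=; apply: ab => i.
    have /(congr1 snd) := ra i.
    by rewrite trivext_mul_snd r1 scale0r add0r.
  exists (fun i => (c i).1); have /(congr1 fst) := cE => /= ->.
  by rewrite trivext_fst_sum.
exists (fun=> 0); rewrite big1 => [|i _]; last by rewrite mul0r.
have [// | b0] := eqVneq b 0; have [f fE] := trivext_divisible b0 e0.
move: e0_neq0; rewrite -fE ab ?eqxx // => i.
rewrite (_ : a i = 0) ?scale0r //.
by apply: contra_notP a0 => /eqP ai; exists i.
Qed.

Lemma trivext_DAC2 : tuple_DAC2 E.
Proof.
move=> n e v ev; have [r re|c cE] := @R_ann n (fun i => (0, e i)) (0, v).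
  apply: trivext_eq; first by rewrite trivext_mul_fst mulr0.
  rewrite trivext_mul_snd scale0r addr0 /=; apply: ev => i.
  by have /(congr1 snd) := re i; rewrite trivext_mul_snd scale0r addr0.
exists (\row_i (c i).1); have /(congr1 snd) := cE => /= ->.
rewrite trivext_snd_sum; apply: eq_bigr => i _.
by rewrite trivext_mul_snd scale0r addr0 mxE.
Qed.

(** A system over A with right-hand side in E is the system over R with matrix
(B, 0) and right-hand side (0, b). *)
Lemma trivext_mx_injective : mx_injective E.
Proof.
move=> m n B b Bb.
have [y yB|x bE] := dual_exact_solvable (B := tmx B 0)
    (b := tmx 0 (fun i _ => b i) : 'cV_m) R_dual.
  move: yB; rewrite [y]tmx_eta !tmx_mul; set u := (\matrix_(i, j) _) => uB.
  have uB0 : u *m B = 0.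
    apply/matrixP => i j; have /matrixP/(_ i j)/(congr1 fst) := uB.
    by rewrite !mxE.
  rewrite mulmx0 trmx0; apply/matrixP => i j; rewrite !mxE mxact0l addr0.
  apply: trivext_eq => //=; have := congr1 (@^~ i) (Bb u uB0).
  by rewrite /mxact fct_sumE.
exists (fun j => (x j 0).2); apply/funext => i.
have /matrixP/(_ i 0)/(congr1 snd) := bE; rewrite !mxE /= => ->.
rewrite trivext_snd_sum; apply: eq_bigr => j _.
by rewrite !mxE trivext_mul_snd scaler0 addr0.
Qed.

End Necessity.

(** * Fp-injectivity *)

Section FpInjective.
Variable A : comNzRingType.

Lemma row_comb_linear (V : lmodType A) n (u : 'I_n -> V) :
  exists f : {linear 'rV[A]_n -> V}, forall y, f y = (y ** u) 0.
Proof. by apply: linear_of_prop => a y z; rewrite mxactDl mxactZl. Qed.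

Lemma linear_rowE (V : lmodType A) n (f : {linear 'rV[A]_n -> V}) y :
  f y = (y ** (fun j => f (delta_mx 0 j))) 0.
Proof.
rewrite [in LHS](row_sum_delta y) linear_sum; apply: eq_bigr => j _.
by rewrite linearZ_LR.
Qed.

Lemma projective_row n : projective 'rV[A]_n.
Proof.
move=> M N p p_surj f.
have /choice[u uE] j : exists u, p u = f (delta_mx 0 j).
  have : range p (f (delta_mx 0 j)) by rewrite p_surj.
  by move=> [u _ uE]; exists u.
have [g gE] := row_comb_linear u; exists g => y /=.
rewrite gE linear_mxact [RHS]linear_rowE; congr ((_ ** _) _).
by apply/funext => j; rewrite /= uE.
Qed.

(** The resolution P is arbitrary, so it is compared with the given
presentation of M: u maps the free module to P_0 and v maps P_0 back, both
over M. On the kernel of P_0 -> M the cocycle f is a map h, and h u b extends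
to a map K on the free module by hypothesis. Since y - u (v y) lies in the
kernel, the extension of h to P_0 is y |-> h (y - u (v y)) + K (v y). *)
Lemma mx_injective_fp (E : lmodType A) : mx_injective E -> fp_injective E.
Proof.
move=> E_inj M [m [n [b [pi [exact_b pi_surj]]]]] P f fd.
set d := res_d P 0; set eps := res_aug P.
have eps_d x : eps (d x) = 0.
  have : range d (d x) by exists x.
  by rewrite (res_exact0 P).
have d_onto y : eps y = 0 -> exists x, d x = y.
  move=> ey; have : range d y by rewrite (res_exact0 P).
  by move=> [x _ xE]; exists x.
have [u uE] := @projective_row n _ _ eps (res_aug_surj P) pi.
have [v vE] := res_projective pi_surj eps.
have ker_f x x' : d x = d x' -> f x = f x'.
  move=> xx'; apply/eqP; rewrite -subr_eq0 -linearB; apply/eqP.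
  have : range (res_d P 1) (x - x').
    by rewrite (res_exactS P); rewrite /= linearB xx' subrr.
  by move=> [z _ <-].
(* The map induced by f on the image of d; it is linear there and 0 elsewhere. *)
have /choice[h hE] y : exists e, forall x, d x = y -> f x = e.
  have [[x xE]|yx] := pselect (exists x, d x = y).
    by exists (f x) => x'; rewrite -xE => /ker_f.
  by exists 0 => x xE; case: yx; exists x.
have hD a y z : eps y = 0 -> eps z = 0 -> h (a *: y + z) = a *: h y + h z.
  move=> /d_onto[x <-] /d_onto[x' <-].
  rewrite -(hE (d x) x) // -(hE (d x') x') // -(linearP f); apply/esym.
  apply: hE.
  by rewrite linearP.
have h0 : h 0 = 0 by rewrite -(hE 0 0) ?linear0.
have h_sum k (y : 'rV_k) (z : 'I_k -> P 0) : (forall i, eps (z i) = 0) ->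
    h ((y ** z) 0) = (y ** (h \o z)) 0.
  move=> ez; rewrite /mxact.
  suff : eps (\sum_j y 0 j *: z j) = 0 /\
      h (\sum_j y 0 j *: z j) = \sum_j y 0 j *: (h \o z) j by case.
  elim/big_rec2: _ => [|j s t _ [es hs]]; first by rewrite linear0.
  by rewrite linearP ez es scaler0 addr0 hD // hs.
have eu_b x : eps (u (b x)) = 0.
  have -> : eps (u (b x)) = pi (b x) by exact: uE.
  have : range b (b x) by exists x.
  by rewrite exact_b.
pose w i := h (u (b (delta_mx 0 i))).
have ub_w x : h (u (b x)) = (x ** w) 0.
  rewrite -[w]/(h \o (fun i => u (b (delta_mx 0 i)))) -h_sum //.
  rewrite [in LHS](linear_rowE b) linear_mxact; congr (h ((_ ** _) _)).
have [y yB|k kE] := E_inj _ _ (lin1_mx b) w.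
  by apply: mxact_row_eq0; rewrite -ub_w -mul_rV_lin1 yB !linear0.
have [K KE] := row_comb_linear k.
have Kb x : K (b x) = h (u (b x)).
  by rewrite ub_w kE -mxactA mul_rV_lin1 KE.
have ev x : pi (v x) = eps x by exact: vE.
have eu x : eps (u x) = pi x by exact: uE.
have e_sub y : eps (y - u (v y)) = 0 by rewrite linearB eu ev subrr.
have [g gE] : exists g : {linear P 0 -> E},
    forall y, g y = h (y - u (v y)) + K (v y).
  apply: linear_of_prop => a y z.
  rewrite !linearP scalerDr [RHS]addrACA -[X in _ = X + _]hD //.
  by congr (h _ + _); rewrite [LHS]addrACA -scalerDr.
exists g => x; rewrite gE (hE (d x) x) // -/d.
have [t _ tE] : range b (v (d x)) by rewrite exact_b; rewrite /= ev.
rewrite -[X in _ = X + _]scale1r -tE Kb -hD //; last by rewrite tE.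
by rewrite scale1r subrK.
Qed.

End FpInjective.

Section FpInjectiveDivisible.
Variables (A : idomainType) (E : lmodType A).

(** Ext^1 (A / a A, E) = E / a E, computed on the free resolution 0 -> A -> A
-> A / a A. *)
Lemma fp_injective_divisible : fp_injective E -> divisible E.
Proof.
move=> E_fp a a0 e.
have [M [pi [pi_surj pi0]]] :
    exists (M : lmodType A) (pi : {linear 'rV[A]_1 -> M}),
    (forall q, exists y, pi y = q) /\
    forall y, pi y = 0 <-> exists x, y = a *: x.
  apply: quotient_by; split=> [|b _ _ [x ->] [x' ->]].
    by exists 0; rewrite scaler0.
  by exists (b *: x + x'); rewrite scalerDr !scalerA mulrC.
have [g gE] : exists g : {linear 'rV[A]_1 -> 'rV[A]_1}, forall y, g y = a *: y.
  by apply: linear_of_prop => b y z; rewrite scalerDr !scalerA mulrC.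
have g_inj y : g y = 0 -> y = 0.
  by rewrite gE => /eqP; rewrite scalemx_eq0 (negPf a0) => /eqP.
have g0 : g 0 = 0 by rewrite linear0.
have pi_range : range pi = setT.
  by apply/seteqP; split=> // q _; have [y <-] := pi_surj q; exists y.
have g_exact : exact_at g pi.
  apply/seteqP; split=> [_ [y _ <-]|y /pi0[x ->]]; first by apply/pi0; exists y.
  by exists x.
have M_fp : finitely_presented M by exists 1, 1, g, pi.
(* Ranks of the free modules of the resolution: 1, 1, 0, 0 and so on. *)
pose r i : nat := if i is _.+2 then 0 else 1.
pose d i : {linear 'rV[A]_(r i.+1) -> 'rV[A]_(r i)} :=
  match i with 0 => g | k.+1 => mulmxr (0 : 'M_(r k.+2, r k.+1)) end.
have d_exact i : exact_at (d i.+1) (d i).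
  apply/seteqP; split=> [_ [y _ <-]|y].
    by case: i y => [|i] y; rewrite /= mulmx0 ?g0.
  case: i y => [|i] y; first by move=> /g_inj ->; exists 0; rewrite //= mul0mx.
  by move=> _; exists 0; rewrite //= mul0mx [RHS]thinmx0.
pose P := @ProjResolution A M (fun i => 'rV[A]_(r i)) d pi
  (fun i => @projective_row A (r i)) pi_range g_exact d_exact.
have [f fE] := row_comb_linear (cst e : 'I_1 -> E).
have [x|h hE] := E_fp M M_fp P f; first by rewrite /= mulmx0 linear0.
exists (h (const_mx 1)).
have : e = h (g (const_mx 1)).
  by have := hE (const_mx 1 : 'rV_1); rewrite fE /mxact big_ord1 mxE scale1r.
by rewrite gE linearZ_LR.
Qed.

End FpInjectiveDivisible.

(** * Semi-regular trivial extensions *)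

Theorem theorem2p10 (A : idomainType) (E : lmodType A)
    (E_neq0 : exists e : E, e != 0) :
  (semiregular (trivext E) <->
    (GRing.field_axiom A /\ exists f : {linear E -> A^o}, bijective f)
    \/
    [/\ coherent_ring A,
        [/\ divisible E, torsion E & coherent_module E],
        DAC E
      & forall x : A, x != 0 -> finitely_generated (submod (ann_elt E x))])
  /\
  (semiregular (trivext E) <->
    (GRing.field_axiom A /\ exists f : {linear E -> A^o}, bijective f)
    \/
    [/\ coherent_ring A,
        [/\ fp_injective E, torsion E & coherent_module E],
        DAC E
      & forall x : A, x != 0 -> finitely_generated (submod (ann_elt E x))]).
Proof.
have semi_fp : semiregular (trivext E) ->
    (GRing.field_axiom A /\ exists f : {linear E -> A^o}, bijective f) \/
    [/\ coherent_ring A,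
        [/\ fp_injective E, torsion E & coherent_module E],
        DAC E
      & forall x : A, x != 0 -> finitely_generated (submod (ann_elt E x))].
  move=> /semiregular_dual_exact R_dual.
  have [tor|line] := trivext_torsion_or_line R_dual; [right|by left].
  split.
  - exact: fg_relations_coherent (trivext_base_coherent R_dual).
  - split=> //; first exact: mx_injective_fp (trivext_mx_injective R_dual).
    exact: fg_relations_coherent (trivext_module_coherent R_dual).
  - split; first exact/DAC1_tuple/(trivext_DAC1 R_dual).
    exact/DAC2_tuple/(trivext_DAC2 R_dual).
  - by move=> x x0; apply/ann_elt_fgP/(trivext_ann_fg R_dual).
have line_semi : GRing.field_axiom A ->
    (exists f : {linear E -> A^o}, bijective f) -> semiregular (trivext E).
  move=> A_field [f [g fK gK]].
  have h_span v : exists a, v = a *: g 1.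
    exists (f v); apply: (can_inj fK); rewrite linearZ_LR gK.
    by rewrite -[RHS]/(f v * 1) mulr1.
  have h_neq0 : g 1 != 0.
    apply/eqP => g1; have := gK 1; rewrite g1 linear0 => /esym/eqP.
    by rewrite oner_eq0.
  apply/dual_exact_semiregular/trivext_dual_exact.
  - apply: (@line_fg_relations A A_field A^o 1) => a.
    by exists a; rewrite -[RHS]/(a * 1) mulr1.
  - exact: (line_fg_relations A_field h_span).
  - exact: line_divisible.
  - by right; exists (g 1).
  - exact: line_ann.
  - exact: (line_DAC1 A_field h_neq0).
  - exact: (line_DAC2 A_field h_span).
have div_semi : [/\ coherent_ring A,
        [/\ divisible E, torsion E & coherent_module E],
        DAC E
      & forall x : A, x != 0 -> finitely_generated (submod (ann_elt E x))] ->
    semiregular (trivext E).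
  move=> [A_coh [E_div E_tor E_coh] [dac1 dac2] E_ann].
  apply/dual_exact_semiregular/trivext_dual_exact => //.
  - exact: coherent_fg_relations.
  - exact: coherent_fg_relations.
  - by left.
  - by move=> x /E_ann/ann_elt_fgP.
  - exact/DAC1_tuple.
  - exact/DAC2_tuple.
split; split.
- move=> R_semi; have [|[A_coh [_ E_tor E_coh] dac E_ann]] := semi_fp R_semi.
    by left.
  right; split=> //; split=> //.
  exact: trivext_divisible (semiregular_dual_exact R_semi).
- by move=> [[A_field line]|]; [exact: line_semi|exact: div_semi].
- exact: semi_fp.
- move=> [[A_field line]|[A_coh [E_fp E_tor E_coh] dac E_ann]].
    exact: line_semi.
  by apply: div_semi; split=> //; split=> //; exact: fp_injective_divisible.
Qed.
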